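(* The logic $\mathrm{S2S}+\forall^{=1}$ has an undecidable theory.
   Context: $\mathrm{S2S}$ is monadic second-order logic of the full binary tree $(\{\mathtt{L},\mathtt{R}\}^\ast,\mathrm{succ}_L,\mathrm{succ}_R)$ where $\mathrm{succ}_L=\{(w,w\mathtt{L})\}$ and $\mathrm{succ}_R=\{(w,w\mathtt{R})\}$: formulas are built from atoms $\mathrm{succ}_L(x,y)$, $\mathrm{succ}_R(x,y)$, $x\in X$ using $\neg$, $\vee$, first-order quantification over vertices and second-order quantification over sets of vertices. Sets of vertices are identified with trees in $T_{\{0,1\}}=\{0,1\}^{\{\mathtt{L},\mathtt{R}\}^\ast}$. $\mathrm{S2S}+\forall^{=1}$ adds the quantifier $\forall^{=1}X.\,\phi$: a tuple $t$ satisfies $\forall^{=1}X.\,\phi(X,Y_1,\dots,Y_n)$ iff $\mu_t(\{t'\in T_{\{0,1\}}\mid (t',t)\text{ satisfies }\phi\})=1$, where $\mu_t$ is the product probability measure on $T_{\{0,1\}}$ labelling each vertex independently by $0$ or $1$ with probability $\tfrac12$. The theory is the set of sentences true in the full binary tree. *)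

(* Defs.v *)
From HB Require Import structures.
From mathcomp Require Import all_boot all_order all_algebra.
From mathcomp Require Import all_classical all_reals all_analysis.
From mathcomp Require Import lra ring zify.

Set Implicit Arguments.
Unset Strict Implicit.
Unset Printing Implicit Defensive.

Import Order.TTheory GRing.Theory Num.Theory.
Import numFieldNormedType.Exports.

Local Open Scope classical_set_scope.
Local Open Scope ring_scope.

(* A vertex is the word of directions leading to it from the root, with
   false for L and true for R. *)
Definition vertex := seq bool.

Definition cylinders : set (set (vertex -> bool)) :=
  [set C | exists v b, C = [set t | t v = b]].

(* {0,1}^({L,R}^* ) with its product sigma-algebra; the set of vertices coded by
   a tree t is {v | t v = true}. *)
Definition tree := g_sigma_algebraType cylinders.

(* The trees that agree with t on the vertices of s. *)
Definition cylinder (s : seq vertex) (t : tree) : set tree :=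
  [set t' : tree | forall v, v \in s -> t' v = t v].

Definition is_coin_measure (R : realType) (mu : probability tree R) :=
  forall (s : seq vertex) (t : tree), uniq s ->
    mu (cylinder s t) = ((2^-1) ^+ size s)%:E.

(* Existence of the coin measure: the image of the Lebesgue measure on [0, 1[
   by the binary digits. *)
Section coin_exists.
Variable R : realType.

Lemma cylinder_cons v s (t : tree) :
  cylinder (v :: s) t = [set t' : tree | t' v = t v] `&` cylinder s t.
Proof.
rewrite /cylinder; apply/seteqP; split => [t' /= h|t' /= [h1 h2] w].
  by split=> [|w ws]; apply: h; rewrite inE ?eqxx // ws orbT.
by rewrite inE => /orP[/eqP->//|]; exact: h2.
Qed.

Lemma cylinder1_measurable v b : measurable ([set t' : tree | t' v = b] : set tree).
Proof. by apply: sub_sigma_algebra; exists v, b. Qed.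

Lemma cylinder_measurable s t : measurable (cylinder s t).
Proof.
elim: s => [|v s IH]; last first.
  by rewrite cylinder_cons; apply: measurableI => //; exact: cylinder1_measurable.
by rewrite (_ : cylinder _ _ = setT) //; apply/seteqP; split.
Qed.

Definition bit (x : R) (i : nat) : bool := odd (Num.truncn (x * 2 ^+ i.+1)).

Definition bits (x : R) : tree := fun v => bit x (pickle v).

Lemma truncn_half (y : R) : 0 <= y -> Num.truncn y = (Num.truncn (y * 2))./2.
Proof.
move=> y0; apply: truncn_def; have y20 : 0 <= y * 2 by rewrite mulr_ge0.
have /andP[h1 h2] := truncn_itv y20.
set m := Num.truncn (y * 2) in h1 h2 *.
have e : m = (odd m + (m./2).*2)%N by rewrite odd_double_half.
have e' : m%:R = (odd m)%:R + 2 * (m./2)%:R :> R.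
  by rewrite [in LHS]e natrD -muln2 natrM mulrC.
have {}h2 : y * 2 < m%:R + 1 by rewrite natr1.
have o1 : ((odd m)%:R : R) <= 1 by case: (odd m).
have o0 : 0 <= ((odd m)%:R : R) by case: (odd m).
by apply/andP; split; rewrite -?natr1; lra.
Qed.

(* The integer with binary expansion b 0 ... b (n-1). *)
Fixpoint bits_num (b : nat -> bool) n : nat :=
  if n is n'.+1 then (b n' + (bits_num b n').*2)%N else 0%N.

Lemma bits_num_lt b n : (bits_num b n < 2 ^ n)%N.
Proof. by elim: n => //= n IH; rewrite expnS; case: (b n); lia. Qed.

Lemma bitsP b n (x : R) : 0 <= x < 1 ->
  (forall i, (i < n)%N -> bit x i = b i) <-> Num.truncn (x * 2 ^+ n) = bits_num b n.
Proof.
move=> /andP[x0 x1]; elim: n => [|n IH].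
  split=> // _; rewrite expr0 mulr1 /=; apply: truncn_def.
  by rewrite x0 x1.
have half : Num.truncn (x * 2 ^+ n) = (Num.truncn (x * 2 ^+ n.+1))./2.
  by rewrite exprSr mulrA -truncn_half // mulr_ge0 // exprn_ge0.
split=> [h|/= h].
  have /IH h1 : forall i, (i < n)%N -> bit x i = b i by move=> i ?; apply: h; lia.
  have := h n (leqnn _); rewrite /bit /= => <-; rewrite -h1 half.
  by rewrite odd_double_half.
have /IH h1 : Num.truncn (x * 2 ^+ n) = bits_num b n.
  by rewrite half h half_bit_double.
move=> i; rewrite ltnS leq_eqVlt => /orP[/eqP->|]; last exact: h1.
by rewrite /bit h oddD odd_double addbF oddb.
Qed.

Lemma measurable_bit i b : measurable [set x : R | bit x i = b].
Proof.
have mge c : measurable [set x : R | c <= x * 2 ^+ i.+1].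
  rewrite (_ : mkset _ = [set` `[c / 2 ^+ i.+1, +oo[]) //.
  apply/seteqP; split=> x /=; rewrite in_itv /= andbT ler_pdivrMr //;
    exact: exprn_gt0.
have m1 : measurable [set x : R | bit x i].
  rewrite (_ : mkset _ = \bigcup_m ([set x : R | odd m.+1 /\
      m.+1%:R <= x * 2 ^+ i.+1] `\` [set x : R | m.+2%:R <= x * 2 ^+ i.+1])).
    apply: bigcup_measurable => m _; apply: measurableD => //.
    case: (boolP (odd m.+1)) => _.
      by rewrite (_ : mkset _ = [set x : R | m.+1%:R <= x * 2 ^+ i.+1]) //;
        apply/seteqP; split=> x //= [].
    by rewrite (_ : mkset _ = set0) //; apply/seteqP; split=> x //= [].
  apply/seteqP; split=> [x /=|x [m _ [/= [om h1] h2]]].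
    rewrite /bit; case E : (Num.truncn _) => [//|m] om; exists m => //.
    by split=> /=; [split=> //|]; rewrite -truncn_gt_nat E // ltnn.
  rewrite /bit (_ : Num.truncn _ = m.+1) //; apply/eqP.
  move: h1 h2; rewrite -!truncn_gt_nat => h1 /negP; rewrite -leqNgt => h2.
  by rewrite eqn_leq h1 h2.
case: b => //.
rewrite (_ : mkset _ = ~` [set x : R | bit x i]); first exact: measurableC.
by apply/seteqP; split=> x /=; [move=> -> | case: (bit x i)].
Qed.

Lemma measurable_bits : measurable_fun [set: measurableTypeR R] bits.
Proof.
apply: (@measurability _ _ (measurableTypeR R) tree setT bits cylinders) => //.
move=> _ [_ [v [b ->]] <-]; rewrite setTI; exact: measurable_bit.
Qed.

Let D : set (measurableTypeR R) := [set` `[(0:R), 1[].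
Let mD : measurable D. Proof. exact: measurable_itv. Qed.

Let nu : {measure set (measurableTypeR R) -> \bar R} :=
  mrestr (@lebesgue_measure R) mD.

Let agree (s : seq nat) (b : nat -> bool) : set (measurableTypeR R) :=
  [set x | forall i, i \in s -> bit x i = b i].

Let agree_cons i s b : agree (i :: s) b = [set x : R | bit x i = b i] `&` agree s b.
Proof.
apply/seteqP; split=> [x /= h|x /= [h1 h2] j].
  by split=> [|j js]; apply: h; rewrite inE ?eqxx // js orbT.
by rewrite inE => /orP[/eqP->//|]; exact: h2.
Qed.

Let agree_measurable s b : measurable (agree s b).
Proof.
elim: s => [|i s IH]; last first.
  by rewrite agree_cons; apply: measurableI => //; exact: measurable_bit.
by rewrite (_ : agree _ _ = setT) //; apply/seteqP; split.
Qed.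

Let nu_prefix b n : nu (agree (iota 0 n) b) = ((2^-1) ^+ n)%:E.
Proof.
have p2 : (0 : R) < 2 ^+ n by exact: exprn_gt0.
pose k : R := (bits_num b n)%:R.
rewrite /nu /= /mrestr.
have -> : agree (iota 0 n) b `&` D = [set` `[k / 2 ^+ n, (k + 1) / 2 ^+ n[].
  apply/seteqP; split=> x /=; rewrite !in_itv /=.
    move=> [h x01]; have /andP[x0 x1] := x01.
    have /(bitsP b n x01) h1 : forall i, (i < n)%N -> bit x i = b i.
      by move=> i ni; apply: h; rewrite mem_iota.
    have := truncn_itv (mulr_ge0 x0 (ltW p2)).
    by rewrite h1 -[(bits_num b n).+1%:R]natr1 (ler_pdivrMr _ _ p2) (ltr_pdivlMr _ _ p2).
  rewrite (ler_pdivrMr _ _ p2) (ltr_pdivlMr _ _ p2) => h.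
  have x01 : 0 <= x < 1.
    case/andP: h => h1 h2; apply/andP; split.
      by rewrite -(pmulr_lge0 _ p2) (le_trans _ h1) // ler0n.
    rewrite -(ltr_pM2r p2) mul1r (lt_le_trans h2) //.
    by rewrite natr1 -natrX ler_nat bits_num_lt.
  split=> //= i; rewrite mem_iota add0n => /= ni.
  apply: (proj2 (bitsP b n x01) _ i ni); apply: truncn_def.
  by rewrite -[(bits_num b n).+1%:R]natr1.
rewrite lebesgue_measure_itv /= lte_fin ltr_pM2r ?invr_gt0 // ltrDl ltr01.
by rewrite -EFinB -mulrBl addrAC subrr add0r mul1r exprVn.
Qed.

Let nu_agree d s b : uniq s -> {subset s <= iota 0 (size s + d)} ->
  nu (agree s b) = ((2^-1) ^+ size s)%:E.
Proof.
elim: d s b => [|d IH] s b us sN.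
  rewrite addn0 in sN; rewrite -(nu_prefix b); congr (nu _).
  have [_ e] := uniq_min_size us sN (eq_leq (size_iota _ _)).
  by apply/seteqP; split=> x h i /=; [rewrite -e|rewrite e]; exact: h.
have [i iN is_] : exists2 i, i \in iota 0 (size s + d.+1) & i \notin s.
  apply: contrapT => h.
  have /uniq_leq_size : {subset iota 0 (size s + d.+1) <= s}.
    by move=> i iN; apply/negPn/negP => nis; apply: h; exists i.
  by rewrite iota_uniq size_iota => /(_ isT); lia.
pose b' := [eta b with i |-> ~~ b i].
have key c : c =1 b \/ c =1 b' ->
    nu ([set x : R | bit x i = c i] `&` agree s b) = ((2^-1) ^+ (size s).+1)%:E.
  move=> cb; rewrite -(IH (i :: s) c) /=.
  - rewrite agree_cons; congr (nu (_ `&` _)).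
    have e j : j \in s -> c j = b j.
      case: cb => -> //= js; rewrite /b' /=; case: eqP => // ji.
      by rewrite -ji js in is_.
    by apply/seteqP; split=> x h j js; have := h j js; rewrite e.
  - by rewrite /= is_.
  - by move=> j; rewrite -[0%N :: _]/(iota 0 (size s + d).+1) -addnS inE => /orP[/eqP->//|]; exact: sN.
have -> : agree s b = ([set x : R | bit x i = b i] `&` agree s b) `|`
                      ([set x : R | bit x i = b' i] `&` agree s b).
  rewrite -setIUl (_ : _ `|` _ = setT) ?setTI //.
  apply/seteqP; split=> // x _; rewrite /b' /= eqxx.
  by case: (bit x i) (b i) => -[]; [left|right|right|left].
rewrite measureU.
- transitivity (((2^-1) ^+ (size s).+1)%:E + ((2^-1) ^+ (size s).+1)%:E : \bar R)%E.
    by congr (_ + _)%E; apply: key; [left|right].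
  by rewrite -EFinD exprS; congr (_%:E); lra.
- by apply: measurableI => //; exact: measurable_bit.
- by apply: measurableI => //; exact: measurable_bit.
apply/seteqP; split=> // x [[/= -> _] [+ _]]; rewrite /b' /= eqxx.
by case: (b i).
Qed.

Let m0 : set tree -> \bar R := fun A => nu (bits @^-1` A).

Let bits_preimage (A : set tree) :
  measurable A -> measurable (bits @^-1` A : set (measurableTypeR R)).
Proof. by move=> mA; rewrite -[X in measurable X]setTI; exact: measurable_bits. Qed.

Let m0_0 : m0 set0 = 0%E.
Proof. by rewrite /m0 preimage_set0 measure0. Qed.

Let m0_ge0 A : (0 <= m0 A)%E.
Proof. exact: measure_ge0. Qed.

Let m0_sigma_additive : semi_sigma_additive m0.
Proof.
move=> F mF tF mUF; rewrite /m0 preimage_bigcup.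
apply: measure_semi_sigma_additive.
- by move=> n; exact: bits_preimage.
- apply/trivIsetP => /= i j _ _ ij; rewrite -preimage_setI.
  by move/trivIsetP : tF => /(_ _ _ _ _ ij) ->//; rewrite preimage_set0.
- by rewrite -preimage_bigcup; exact: bits_preimage.
Qed.

HB.instance Definition _ := isMeasure.Build _ _ _ m0 m0_0 m0_ge0 m0_sigma_additive.

Let m0_setT : m0 setT = 1%E.
Proof.
rewrite /m0 preimage_setT -(nu_prefix (fun=> false) 0); congr (nu _).
by apply/seteqP; split.
Qed.

HB.instance Definition _ := @Measure_isProbability.Build _ _ R m0 m0_setT.

Lemma coin_exists : exists mu : probability tree R, is_coin_measure mu.
Proof.
exists m0 => s t us.
pose b i := t (odflt [::] (unpickle i)).
have inj : injective (@pickle vertex) by exact: pcan_inj pickleK.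
rewrite -(size_map pickle) -(@nu_agree (\max_(v <- s) (pickle v).+1) _ b).
- congr (nu _); apply/seteqP; split=> x /= h.
    move=> _ /mapP[v vs ->]; have := h v vs.
    by rewrite /bits /b pickleK.
  by move=> v vs; have := h _ (map_f pickle vs); rewrite /bits /b pickleK.
- by rewrite map_inj_uniq.
move=> _ /mapP[v vs ->]; rewrite mem_iota /= add0n.
by rewrite (leq_trans _ (leq_addl _ _)) // leq_bigmax_seq.
Qed.

End coin_exists.

Definition coin (R : realType) : probability tree R :=
  projT1 (cid (coin_exists R)).

Lemma coinP (R : realType) : is_coin_measure (coin R).
Proof. exact: (projT2 (cid (coin_exists R))). Qed.

Lemma coin_unique (R : realType) (mu : probability tree R) :
  is_coin_measure mu -> forall A, measurable A -> mu A = coin R A.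
Proof.
move=> mu_coin.
pose G : set (set tree) := [set C | C = set0 \/
  exists s t, uniq s /\ C = cylinder s t].
have Gm : G `<=` measurable.
  by move=> _ [->|[s [t [_ ->]]]]; [exact: measurable0|exact: cylinder_measurable].
have cylT t : cylinder [::] t = setT by apply/seteqP; split.
apply: (measure_unique G (fun=> setT)).
- apply/seteqP; split; last exact: smallest_sub (@sigma_algebra_measurable _ tree) Gm.
  apply: smallest_sub; first exact: smallest_sigma_algebra.
  move=> _ [v [b ->]]; apply: sub_sigma_algebra; right.
  exists [:: v], (fun=> b); split=> //.
  apply/seteqP; split=> t /=; last by apply; rewrite inE.
  by move=> tv w; rewrite inE => /eqP ->.
- move=> C C' [->|[s [t [us ->]]]]; first by left; rewrite set0I.
  move=> [->|[s' [t' [us' ->]]]]; first by left; rewrite setI0.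
  have [[t'' [/= h h']]|] := pselect (cylinder s t `&` cylinder s' t' !=set0);
    last by move/set0P/negP/negPn/eqP => ->; left.
  right; exists (undup (s ++ s')), t''; split; first exact: undup_uniq.
  apply/seteqP; split=> u /=.
    move=> [k k'] v; rewrite mem_undup mem_cat => /orP[vs|vs].
      by rewrite k // h.
    by rewrite k' // h'.
  move=> k; have k' v : (v \in s) || (v \in s') -> u v = t'' v.
    by move=> vs; apply: k; rewrite mem_undup mem_cat.
  by split=> v vs; rewrite k' ?vs ?orbT //; [exact: h|exact: h'].
- by move=> _; right; exists [::], (fun=> false).
- by rewrite bigcup_const //; exists 0%N.
- move=> _ [->|[s [t [us ->]]]]; first by rewrite !measure0.
  transitivity (((2^-1) ^+ size s)%:E : \bar R); first exact: mu_coin.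
  by apply/esym; exact: coinP.
- by move=> _; apply: (le_lt_trans (@probability_le1 _ _ _ mu setT _)); rewrite ?ltry.
Qed.

(* "A has measure 1" is read in the completion of mu, since definable sets of
   trees need not be Borel. *)
Definition has_measure1 (R : realType) (mu : probability tree R) (A : set tree) :=
  (mu^*)%mu.-cara.-measurable A /\ @completed_measure_extension _ _ _ mu A = 1%E.

Lemma mu_ext0_negligible (R : realType) (mu : probability tree R) (N : set tree) :
  (mu^*)%mu N = 0%E -> mu.-negligible N.
Proof.
move=> N0.
have cover n : exists F : (set tree)^nat, measurable_cover N F /\
    (\sum_(k <oo) mu (F k) < (n.+1%:R^-1)%:E)%E.
  have : ((mu^*)%mu N < (n.+1%:R^-1)%:E)%E by rewrite N0 lte_fin invr_gt0.
  by move=> /ereal_inf_lt[_ [F NF <-]] ?; exists F.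
pose F n := projT1 (cid (cover n)).
have mF n k : measurable (F n k).
  by have [[+ _] _] := projT2 (cid (cover n)); apply.
pose B := \bigcap_n \bigcup_k F n k.
have mB : measurable B.
  by apply: bigcapT_measurable => n; apply: bigcupT_measurable => k; exact: mF.
exists B; split=> //.
  apply/eqP; rewrite eq_le measure_ge0 andbT.
  apply/lee_addgt0Pr => e e0; rewrite add0e.
  have [n ne] : exists n : nat, n.+1%:R^-1 < e.
    exists (Num.truncn e^-1); rewrite invf_plt ?posrE // truncnS_gt //.
  have [_ h] := projT2 (cid (cover n)).
  apply: (le_trans _ (ltW (lt_le_trans h _))); last by rewrite lee_fin ltW.
  apply: (@le_trans _ _ (mu (\bigcup_k F n k))).
    apply: le_measure; rewrite ?inE //; last by move=> x; exact.
    by apply: bigcupT_measurable => k; exact: mF.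
  apply: measure_sigma_subadditive => //; first exact: mF.
  by apply: bigcupT_measurable => k; exact: mF.
move=> x Nx n _; have [[_ h] _] := projT2 (cid (cover n)).
exact: h.
Qed.

Lemma has_measure1P (R : realType) (mu : probability tree R) (A : set tree) :
  has_measure1 mu A <-> {ae mu, forall t, A t}.
Proof.
have muT : (mu^*)%mu setT = 1%E.
  by rewrite measurable_mu_extE //; exact: probability_setT.
have split1 : (mu^*)%mu.-cara.-measurable A ->
    (1 = (mu^*)%mu A + (mu^*)%mu (~` A))%E.
  by move=> /(_ setT) h; rewrite -[LHS]muT (h : (mu^*)%mu setT = _) !setTI.
split=> [[mA A1]|].
  apply: mu_ext0_negligible.
  have := split1 mA; rewrite /completed_measure_extension in A1; rewrite A1.
  have : (0 <= (mu^*)%mu (~` A))%E by apply: mu_ext_ge0 => ?; exact: measure_ge0.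
  case: ((mu^*)%mu (~` A)) => //= r r0; rewrite -EFinD => -[h]; congr (_%:E).
  by lra.
move=> [B [mB B0 NB]].
have N0 : (mu^*)%mu (~` A) = 0%E.
  apply/eqP; rewrite eq_le (mu_ext_ge0 (@measure_ge0 _ _ _ mu)) andbT -B0.
  rewrite -measurable_mu_extE //.
  exact: le_mu_ext.
have mN : (mu^*)%mu.-cara.-measurable (~` A).
  apply: (@measure_is_complete_caratheodory R tree (mu^* )%mu); exists B; split=> //.
    exact: caratheodory_measurable_mu_ext.
  by apply: etrans B0; exact: measurable_mu_extE.
have mA : (mu^*)%mu.-cara.-measurable A by rewrite -(setCK A); exact: measurableC.
by split=> //; have := split1 mA; rewrite N0 adde0.
Qed.

(* Variables are numbered; first-order and second-order variables are distinct
   sorts. [AllP X p] is the quantifier forall^{=1} X, p. *)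
Inductive formula :=
| SuccL (x y : nat)
| SuccR (x y : nat)
| In (x X : nat)
| Not (p : formula)
| Or (p q : formula)
| Ex1 (x : nat) (p : formula)
| All1 (x : nat) (p : formula)
| Ex2 (X : nat) (p : formula)
| All2 (X : nat) (p : formula)
| AllP (X : nat) (p : formula).

Definition upd (A : Type) (f : nat -> A) (i : nat) (a : A) : nat -> A :=
  [eta f with i |-> a].

Fixpoint sat (R : realType) (e : nat -> vertex) (E : nat -> tree) (p : formula)
    : Prop :=
  match p with
  | SuccL x y => e y = rcons (e x) false
  | SuccR x y => e y = rcons (e x) true
  | In x X => E X (e x) = true
  | Not p => ~ sat R e E p
  | Or p q => sat R e E p \/ sat R e E q
  | Ex1 x p => exists v : vertex, sat R (upd e x v) E p
  | All1 x p => forall v : vertex, sat R (upd e x v) E p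
  | Ex2 X p => exists t : tree, sat R e (upd E X t) p
  | All2 X p => forall t : tree, sat R e (upd E X t) p
  | AllP X p => has_measure1 (coin R) [set t | sat R e (upd E X t) p]
  end.

Fixpoint free1 (p : formula) : seq nat :=
  match p with
  | SuccL x y | SuccR x y => [:: x; y]
  | In x _ => [:: x]
  | Or p q => free1 p ++ free1 q
  | Ex1 x p | All1 x p => [seq y <- free1 p | y != x]
  | Not p | Ex2 _ p | All2 _ p | AllP _ p => free1 p
  end.

Fixpoint free2 (p : formula) : seq nat :=
  match p with
  | SuccL _ _ | SuccR _ _ => [::]
  | In _ X => [:: X]
  | Or p q => free2 p ++ free2 q
  | Not p | Ex1 _ p | All1 _ p => free2 p
  | Ex2 X p | All2 X p | AllP X p => [seq Y <- free2 p | Y != X]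
  end.

Definition sentence (p : formula) := free1 p = [::] /\ free2 p = [::].

(* The truth of a sentence does not depend on the valuations. *)
Definition theory (R : realType) : set formula :=
  [set p | sentence p /\ forall e E, sat R e E p].

(* Goedel numbering: the Polish notation of a formula, as a word over nat,
   followed by the binary coding of words of the choice library. *)
Fixpoint word (p : formula) : seq nat :=
  match p with
  | SuccL x y => [:: 0; x; y]
  | SuccR x y => [:: 1; x; y]
  | In x X => [:: 2; x; X]
  | Not p => 3 :: word p
  | Or p q => 4 :: word p ++ word q
  | Ex1 x p => 5 :: x :: word p
  | All1 x p => 6 :: x :: word p
  | Ex2 X p => 7 :: X :: word p
  | All2 X p => 8 :: X :: word p
  | AllP X p => 9 :: X :: word p
  end%N.

Definition godel (p : formula) : nat := CodeSeq.code (word p).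

Lemma godel_inj : injective godel.
Proof.
suff pre p q s t : word p ++ s = word q ++ t -> p = q /\ s = t.
  move=> p q /(can_inj CodeSeq.codeK) e.
  by have [] := pre p q [::] [::]; rewrite ?cats0.
elim: p q s t => [x y|x y|x X|p IH|p IHp q IHq|x p IH|x p IH|X p IH|X p IH|X p IH]
  [x' y'|x' y'|x' X'|p'|p' q'|x' p'|x' p'|X' p'|X' p'|X' p'] s t //=;
  rewrite -?catA.
all: try by case=> -> -> ->.
all: try by case=> -> /IH[-> ->].
- by case=> /IH[-> ->].
- by case=> /IHp[-> /IHq[-> ->]].
Qed.

(* Minsky register machines. [Dec r l] jumps to l if register r is zero, and
   otherwise decrements it and goes on; the machine halts when the program
   counter leaves the program. *)
Inductive instr := Inc (r : nat) | Dec (r l : nat).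

Definition config := (nat * (nat -> nat))%type.

Definition step (P : seq instr) (c : config) : config :=
  let: (pc, g) := c in
  match onth P pc with
  | Some (Inc r) => (pc.+1, upd g r (g r).+1)
  | Some (Dec r l) =>
      if g r is n.+1 then (pc.+1, upd g r n) else (l, g)
  | None => c
  end.

Definition start (n : nat) : config := (0%N, upd (fun=> 0%N) 0%N n).

(* P computes from input n, in register 0, the output m, in register 0. *)
Definition computes (P : seq instr) (n m : nat) : Prop :=
  exists k, let c := iter k (step P) (start n) in
    (size P <= c.1)%N /\ c.2 0%N = m.

Definition decidable_set (S : set nat) : Prop :=
  exists P : seq instr, forall n : nat,
    (S n -> computes P n 1%N) /\ (~ S n -> computes P n 0%N).

(* Main.v *)
(* A candidate halting computation of a register machine is written on the
   vertices R^i L^(j+1) R^k: in round i, the content of a register at time j is the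
   height of the column k |-> R^i L^(j+1) R^k of a set of vertices, and i ranges
   over infinitely many rounds, each of which is supposed to contain the same
   computation. Monadic second-order logic expresses everything about a round,
   except that two consecutive columns have the same height: writing a for the
   height expected at the next time and b for the height found there, it cannot
   say that a = b.

   The measure quantifier does this. By the two Borel-Cantelli lemmas, for disjoint
   finite sets of vertices F_i, almost every tree contains infinitely many F_i if
   and only if the sum of the 2^-|F_i| diverges. Select one cell in each of
   infinitely many rounds, and cut the rounds into groups. If always a = b, the
   unions over the groups of the selected a-columns and of the b-columns have the
   same sizes, and hence the same almost sure behaviour. Conversely, if every round
   has an error, then, the heights being bounded in the sense that almost every
   tree contains infinitely many of the selected columns, infinitely many errors
   have the same a <> b; say a < b. With 2^(a k) groups of k errors for each k, the
   sum for the a-columns diverges and the sum for the b-columns converges. So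
   "for all selections and groupings, both are almost sure or neither is"
   expresses that the machine halts on an input n, given as the set of all
   vertices u L R^k with k < n.

   Now let P decide the theory. From the code n of a formula psi, a machine D computes
   the code of the sentence "psi at n" by prefixing n times a fixed word to that of
   psi; it then runs P and halts if and only if the answer is negative. Taking for
   psi the formula saying that D halts gives a contradiction. *)

From mathcomp Require Import all_boot all_order all_algebra.
From mathcomp Require Import all_classical all_reals all_analysis.
From mathcomp Require Import lra ring zify.
Require Import Defs.

Set Implicit Arguments.
Unset Strict Implicit.
Unset Printing Implicit Defensive.

Import Order.TTheory GRing.Theory Num.Theory.

(** * Borel-Cantelli lemmas for the coin measure *)

Section coin_runs.
Local Open Scope classical_set_scope.
Local Open Scope ring_scope.
Variable R : realType.
Local Notation mu := (coin R).

Definition ones (s : seq vertex) : set tree := [set t : tree | forall v, v \in s -> t v = true].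

Lemma onesE s : ones s = cylinder s (fun=> true).
Proof. by []. Qed.

Lemma measurable_ones s : measurable (ones s).
Proof. by rewrite onesE; exact: cylinder_measurable. Qed.

Lemma coin_ones s : uniq s -> mu (ones s) = ((2^-1) ^+ size s)%:E.
Proof. by move=> us; rewrite onesE; exact: coinP. Qed.

Lemma ones_cat s s' : ones (s ++ s') = ones s `&` ones s'.
Proof.
apply/seteqP; split=> [t h|t [h h'] v]; last by rewrite mem_cat => /orP[/h|/h'].
by split=> v vs; apply: h; rewrite mem_cat vs ?orbT.
Qed.

Definition none (F : seq (seq vertex)) : set tree :=
  foldr (fun s A => A `\` ones s) setT F.

Lemma measurable_none F : measurable (none F).
Proof. by elim: F => //= s F IH; apply: measurableD => //; exact: measurable_ones. Qed.

(** The factor [ones s] makes the induction on [F] work: removing [ones u] subtracts the same event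
    for [s ++ u], to which the induction hypothesis applies again. *)
Lemma coin_none (s : seq vertex) (F : seq (seq vertex)) : uniq (s ++ flatten F) ->
  mu (ones s `&` none F) =
  ((2^-1) ^+ size s * \prod_(u <- F) (1 - (2^-1) ^+ size u))%:E.
Proof.
elim: F s => [|u F IH] s /=.
  by rewrite cats0 big_nil mulr1 setIT; exact: coin_ones.
move=> us; have us2 : uniq ((s ++ u) ++ flatten F) by rewrite -catA.
have us1 : uniq (s ++ flatten F).
  move: us; rewrite !cat_uniq => /and3P[-> h /and3P[_ _ ->]]; rewrite andbT /=.
  by apply: contra h => /hasP[v vF vs]; apply/hasP; exists v; rewrite // mem_cat vF orbT.
rewrite setDE setIA -setDE measureD.
- rewrite setIAC -ones_cat big_cons.
  transitivity (((2^-1) ^+ size s * \prod_(u <- F) (1 - (2^-1) ^+ size u))%:E -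
    ((2^-1) ^+ size (s ++ u) * \prod_(u <- F) (1 - (2^-1) ^+ size u))%:E : \bar R)%E.
    by congr (_ - _)%E; apply: IH.
  by rewrite -EFinB size_cat exprD; congr (_%:E); ring.
- by apply: measurableI; [exact: measurable_ones|exact: measurable_none].
- exact: measurable_ones.
- rewrite (@le_lt_trans _ _ 1%E) ?ltry //; apply: probability_le1.
  by apply: measurableI; [exact: measurable_ones|exact: measurable_none].
Qed.

(** Since [(1 - p) * (1 + p + S) <= 1 + S], the factors can be removed one by one. This bound on the
    product takes the place of the usual exponential one. *)
Lemma prod_1B_le (T : Type) (s : seq T) (p : T -> R) : (forall x, 0 <= p x <= 1) ->
  \prod_(x <- s) (1 - p x) * (1 + \sum_(x <- s) p x) <= 1.
Proof.
move=> p01; elim: s => [|x s IH]; first by rewrite !big_nil addr0 mulr1.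
rewrite !big_cons; apply: le_trans IH.
rewrite mulrAC mulrC ler_wpM2l //; last first.
  have := p01 x; have : 0 <= \sum_(j <- s) p j.
    by apply: sumr_ge0 => y _; case/andP: (p01 y).
  move: (\sum_(j <- s) p j) (p x) => S q S0 /andP[q0 q1]; nra.
by apply: prodr_ge0 => y _; case/andP: (p01 y) => _; rewrite subr_ge0.
Qed.

Variables (I : pred nat) (F : nat -> seq vertex).
Hypothesis F_uniq : forall i, I i -> uniq (F i).
Hypothesis F_disj : forall i j v, I i -> I j -> v \in F i -> v \in F j -> i = j.

Let p i : R := if I i then (2^-1) ^+ size (F i) else 0.

Let half01 n : 0 <= ((2^-1) ^+ n : R) <= 1.
Proof. by rewrite exprn_ge0 ?exprn_ile1 ?invr_ge0 ?invf_le1 //; lra. Qed.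

Let p01 i : 0 <= p i <= 1.
Proof. by rewrite /p; case: (I i); rewrite ?lexx ?ler01 ?half01. Qed.

Definition infinitely_often (t : tree) : Prop :=
  forall m, exists2 i, (m <= i)%N & I i /\ ones (F i) t.

(** Second Borel-Cantelli lemma. The trees without any [F i] for [i >= m] lie in every [B n], the
    event for [m <= i < m + n], whose measure is a product of factors [1 - p i] and becomes
    arbitrarily small. *)
Lemma ae_infinitely_often :
  (forall C : R, exists n, C <= \sum_(i < n) p i) ->
  {ae mu, forall t, infinitely_often t}.
Proof.
move=> div; pose E m := [set t : tree | forall i, (m <= i)%N -> I i -> ~ ones (F i) t].
suff EN m : mu.-negligible (E m).
  apply: negligibleS (negligible_bigcup EN) => t /= h.
  apply: contrapT => h'; apply: h => m; apply: contrapT => h.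
  apply: h'; exists m => // i mi Ii o; apply: h.
  by exists i.
pose r n := [seq i <- iota m n | I i].
pose B n := none [seq F i | i <- r n].
have EB n : E m `<=` B n.
  move=> t Et; rewrite /B.
  have : all (fun i => (m <= i)%N && I i) (r n).
    by apply/allP => i; rewrite mem_filter mem_iota => /andP[-> /andP[-> _]].
  elim: (r n) => //= i s IH /andP[/andP[mi Ii] /IH h]; split=> //.
  exact: Et.
have mB n : measurable (B n) by exact: measurable_none.
have Bu n : uniq (flatten [seq F i | i <- r n]).
  have : uniq (r n) by rewrite filter_uniq // iota_uniq.
  have : all I (r n) by exact: filter_all.
  elim: (r n) => //= i s IH /andP[Ii Is] /andP[is_ us].
  rewrite cat_uniq F_uniq // IH // andbT /=.
  apply/hasPn => v /flatten_mapP[j js vj]; apply/negP => vi.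
  by move: is_; rewrite (F_disj Ii _ vi vj) ?js //; exact: (allP Is).
have muB n : mu (B n) = (\prod_(i <- r n) (1 - p i))%:E.
  have -> : B n = ones [::] `&` B n.
    by rewrite (_ : ones _ = setT) ?setTI //; apply/seteqP; split.
  rewrite coin_none //= ?expr0 mul1r big_map !big_filter.
  by congr (_%:E); apply: eq_bigr => i Ii; rewrite /p Ii.
exists (\bigcap_n B n); split.
- exact: bigcapT_measurable.
- apply/eqP; rewrite eq_le measure_ge0 andbT.
  apply/lee_addgt0Pr => e e0; rewrite add0e.
  (* The terms before [m] sum to at most [m], which leaves [e^-1] for those from [m] on. *)
  have [n ne] := div (m%:R + e^-1).
  apply: (@le_trans _ _ (mu (B n))).
    by apply: le_measure; rewrite ?inE //; [exact: bigcapT_measurable|exact: bigcap_inf].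
  rewrite muB lee_fin.
  have := prod_1B_le (r n) p01.
  have S : e^-1 <= \sum_(i <- r n) p i.
    rewrite big_filter (eq_bigr (fun i => p i)) //.
    have -> : \sum_(i <- iota m n | I i) p i = \sum_(i <- iota m n) p i.
      by rewrite big_mkcond /=; apply: eq_bigr => i _; rewrite /p; case: (I i).
    have : \sum_(i < n) p i <= \sum_(0 <= i < m + n) p i.
      rewrite -(big_mkord xpredT) [leRHS](@big_cat_nat _ _ _ n) //=; last exact: leq_addl.
      by rewrite lerDl sumr_ge0 // => i _; case/andP: (p01 i).
    rewrite (@big_cat_nat _ _ _ m) //=; last exact: leq_addr.
    have : \sum_(0 <= i < m) p i <= m%:R.
      apply: (@le_trans _ _ (\sum_(0 <= i < m) 1)).
        by apply: ler_sum => i _; case/andP: (p01 i).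
      by rewrite big_const_nat subn0 iter_addr_0.
    have -> : index_iota m (m + n) = iota m n by rewrite /index_iota addKn.
    lra.
  set P := \prod_(i <- r n) _; set s := \sum_(i <- r n) _ in S *.
  have P0 : 0 <= P by apply: prodr_ge0 => i _; case/andP: (p01 i) => _; rewrite subr_ge0.
  move=> h; have : P * e^-1 <= 1 by apply: le_trans h; apply: ler_wpM2l => //; lra.
  by rewrite ler_pdivrMr // mul1r.
- by move=> t Et n _; exact: EB.
Qed.

(** First Borel-Cantelli lemma: the limit superior of the events is null, so otherwise the whole
    space would be a union of two null sets. *)
Lemma not_ae_infinitely_often (C : R) :
  (forall n, \sum_(i < n) p i <= C) -> ~ {ae mu, forall t, infinitely_often t}.
Proof.
move=> bd ae.
pose A i : set tree := if I i then ones (F i) else set0.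
have mA i : measurable (A i).
  by rewrite /A; case: (I i) => //; exact: measurable_ones.
have muA i : mu (A i) = (p i)%:E.
  rewrite /A /p; case: ifPn => [Ii|_]; last by rewrite measure0.
  exact/coin_ones/F_uniq.
have L0 : mu (lim_sup_set A) = 0%E.
  apply: lim_sup_set_cvg0 => //.
  apply: (@le_lt_trans _ _ C%:E); last by rewrite ltry.
  apply: lime_le; first by apply: is_cvg_nneseries => n _ _; exact: measure_ge0.
  apply: nearW => n; rewrite (eq_bigr (fun i => (p i)%:E)); last by move=> i _; exact: muA.
  by rewrite sumEFin lee_fin big_mkord.
have mL : measurable (lim_sup_set A).
  by apply: bigcapT_measurable => n; apply: bigcup_measurable.
have : mu.-negligible (~` [set t | infinitely_often t] `|` lim_sup_set A).
  by apply: negligibleU => //; exact/negligibleP.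
rewrite (_ : _ `|` _ = setT).
  move/(measure_negligible measurableT) => h.
  by have /eqP := etrans (esym h) (probability_setT mu); rewrite eq_sym onee_eq0.
apply/seteqP; split=> // t _; have [h|h] := pselect (infinitely_often t); last by left.
by right=> m _; have [i mi [Ii o]] := h m; exists i; rewrite // /A Ii.
Qed.

End coin_runs.

(** * Bounded quantifiers *)

Section macros.
Local Open Scope nat_scope.

(* MAll b x y and MEx b x y quantify y over the vertices x b^k, MNext b x y binds y
   to x b, and MRoot x binds x to the root. *)
Inductive mform :=
| MTrue
| MIn (x X : nat)
| MNot (p : mform)
| MAnd (p q : mform)
| MImp (p q : mform)
| MReach (b : bool) (x y : nat)
| MRoot (x : nat) (p : mform)
| MNext (b : bool) (x y : nat) (p : mform)
| MAll (b : bool) (x y : nat) (p : mform)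
| MEx (b : bool) (x y : nat) (p : mform)
| MEx2 (X : nat) (p : mform)
| MAll2 (X : nat) (p : mform)
| MAllP (X : nat) (p : mform).

Definition Succ (b : bool) := if b then SuccR else SuccL.
Definition FImp p q := Or (Not p) q.
Definition FAnd p q := Not (Or (Not p) (Not q)).

(** Reachability as membership in every closed set. [x] and [y] occur outside the scope of the bound
    first-order variables 0 and 1, so nothing is captured. *)
Definition Reach b x y :=
  All2 0 (FImp (In x 0) (FImp
    (All1 0 (All1 1 (FImp (Succ b 0 1) (FImp (In 0 0) (In 1 0))))) (In y 0))).

Definition Root x := Not (Ex1 x.+1 (Or (SuccL x.+1 x) (SuccR x.+1 x))).

Fixpoint compile (m : mform) : formula :=
  match m with
  | MTrue => All1 0 (FImp (In 0 0) (In 0 0))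
  | MIn x X => In x X
  | MNot p => Not (compile p)
  | MAnd p q => FAnd (compile p) (compile q)
  | MImp p q => FImp (compile p) (compile q)
  | MReach b x y => Reach b x y
  | MRoot x p => All1 x (FImp (Root x) (compile p))
  | MNext b x y p => All1 y (FImp (Succ b x y) (compile p))
  | MAll b x y p => All1 y (FImp (Reach b x y) (compile p))
  | MEx b x y p => Ex1 y (FAnd (Reach b x y) (compile p))
  | MEx2 X p => Ex2 X (compile p)
  | MAll2 X p => All2 X (compile p)
  | MAllP X p => AllP X (compile p)
  end.

(** The guard of a bounded quantifier mentions [x] under the binder of [y], so the two must
    differ. *)
Fixpoint mwf (m : mform) : bool :=
  match m with
  | MTrue | MIn _ _ | MReach _ _ _ => true
  | MNot p | MRoot _ p | MEx2 _ p | MAll2 _ p | MAllP _ p => mwf p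
  | MAnd p q | MImp p q => mwf p && mwf q
  | MNext _ x y p | MAll _ x y p | MEx _ x y p => (x != y) && mwf p
  end.

Variable R : realType.

Fixpoint msat (e : nat -> vertex) (E : nat -> tree) (m : mform) : Prop :=
  match m with
  | MTrue => True
  | MIn x X => E X (e x) = true
  | MNot p => ~ msat e E p
  | MAnd p q => msat e E p /\ msat e E q
  | MImp p q => msat e E p -> msat e E q
  | MReach b x y => exists k, e y = e x ++ nseq k b
  | MRoot x p => msat (upd e x [::]) E p
  | MNext b x y p => msat (upd e y (rcons (e x) b)) E p
  | MAll b x y p => forall k, msat (upd e y (e x ++ nseq k b)) E p
  | MEx b x y p => exists k, msat (upd e y (e x ++ nseq k b)) E p
  | MEx2 X p => exists t, msat e (upd E X t) p
  | MAll2 X p => forall t, msat e (upd E X t) p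
  | MAllP X p => {ae coin R, forall t, msat e (upd E X t) p}
  end.

Lemma sat_all1 e E x p :
  sat R e E (All1 x p) <-> forall v, sat R (upd e x v) E p.
Proof. by []. Qed.

Lemma sat_all2 e E X p :
  sat R e E (All2 X p) <-> forall t, sat R e (upd E X t) p.
Proof. by []. Qed.

Lemma sat_ex1 e E x p :
  sat R e E (Ex1 x p) <-> exists v, sat R (upd e x v) E p.
Proof. by []. Qed.

Lemma sat_imp e E p q : sat R e E (FImp p q) <-> (sat R e E p -> sat R e E q).
Proof.
rewrite /=; split=> [[]//|h].
by have [/h|] := pselect (sat R e E p); [right|left].
Qed.

Lemma sat_and e E p q : sat R e E (FAnd p q) <-> sat R e E p /\ sat R e E q.
Proof.
rewrite /=; split=> [h|[hp hq]]; last by case.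
by split; apply: contrapT => h'; apply: h; [left|right].
Qed.

Lemma sat_succ e E b x y : sat R e E (Succ b x y) <-> e y = rcons (e x) b.
Proof. by case: b. Qed.

Lemma rcons_cat_nseq (v : vertex) k b : rcons (v ++ nseq k b) b = v ++ nseq k.+1 b.
Proof. by rewrite rcons_cat -cats1 -(nseqD k 1) addn1. Qed.

Lemma sat_reach e E b x y :
  sat R e E (Reach b x y) <-> exists k, e y = e x ++ nseq k b.
Proof.
rewrite /Reach; set Cl := All1 0 _; split=> [h|[k ey]].
  (* The chain itself is a closed set. *)
  pose T : tree := fun v => `[< exists k, v = e x ++ nseq k b >].
  have /sat_imp h1 : sat R e (upd E 0 T) (FImp (In x 0) (FImp Cl (In y 0))) := h T.
  have /sat_imp h2 : sat R e (upd E 0 T) (FImp Cl (In y 0)).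
    by apply: h1; apply/asboolP; exists 0; rewrite cats0.
  suff /h2/asboolP : sat R e (upd E 0 T) Cl by [].
  apply/sat_all1 => v; apply/sat_all1 => w; apply/sat_imp => /sat_succ vw.
  apply/sat_imp => /asboolP[k vk]; apply/asboolP; exists k.+1.
  by rewrite -rcons_cat_nseq -vk; exact: vw.
apply/sat_all2 => t; apply/sat_imp => tx; apply/sat_imp => h /=; rewrite ey.
elim: k {ey} => [|k IH]; first by rewrite cats0.
rewrite -rcons_cat_nseq; set v := e x ++ _.
have /sat_imp h1 : sat R (upd (upd e 0 v) 1 (rcons v b)) (upd E 0 t)
  (FImp (Succ b 0 1) (FImp (In 0 0) (In 1 0))) := h v (rcons v b).
have /sat_imp h2 : sat R (upd (upd e 0 v) 1 (rcons v b)) (upd E 0 t)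
  (FImp (In 0 0) (In 1 0)) by apply/h1/sat_succ.
exact: h2.
Qed.

Lemma sat_root e E x : sat R e E (Root x) <-> e x = [::].
Proof.
rewrite /Root /= /upd /= eqxx eqn_leq ltnn andbF.
split=> [h|-> [v []]]; try by case: v.
elim/last_ind: (e x) h => // s b _ h; case: h; exists s.
by case: b; [right|left].
Qed.

Lemma compileP m e E : mwf m -> sat R e E (compile m) <-> msat e E m.
Proof.
elim: m e E.
- by move=> e E _; split=> // _; apply/sat_all1 => v; apply/sat_imp.
- by [].
- by move=> p IH e E /IH h; rewrite [sat _ _ _ _]/= h.
- by move=> p IHp q IHq e E /andP[/IHp hp /IHq hq]; rewrite [compile _]/= sat_and hp hq.
- by move=> p IHp q IHq e E /andP[/IHp hp /IHq hq]; rewrite [compile _]/= sat_imp hp hq.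
- by move=> b x y e E _; exact: sat_reach.
- move=> x p IH e E wp; rewrite [compile _]/=; split=> [/sat_all1 h|h].
    have /sat_imp h1 : sat R (upd e x [::]) E (FImp (Root x) (compile p)) := h _.
    apply/(IH _ _ wp)/h1.
    by apply/sat_root; rewrite /upd /= eqxx.
  apply/sat_all1 => v; apply/sat_imp => /sat_root; rewrite /upd /= eqxx => ->; exact/IH.
- move=> b x y p IH e E /andP[/negbTE xy wp]; rewrite [compile _]/=; split=> [/sat_all1 h|h].
    have /sat_imp h1 : sat R (upd e y (rcons (e x) b)) E
      (FImp (Succ b x y) (compile p)) := h _.
    apply/(IH _ _ wp)/h1.
    by apply/sat_succ; rewrite /upd /= eqxx xy.
  apply/sat_all1 => v; apply/sat_imp => /sat_succ; rewrite /upd /= eqxx xy => ->; exact/IH.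
- move=> b x y p IH e E /andP[/negbTE xy wp]; rewrite [compile _]/=; split=> [/sat_all1 h k|h].
    have /sat_imp h1 : sat R (upd e y (e x ++ nseq k b)) E
      (FImp (Reach b x y) (compile p)) := h _.
    apply/(IH _ _ wp)/h1.
    by apply/sat_reach; exists k; rewrite /upd /= eqxx xy.
  apply/sat_all1 => v; apply/sat_imp => /sat_reach[k]; rewrite /upd /= eqxx xy => ->.
  by apply/(IH _ _ wp)/h.
- move=> b x y p IH e E /andP[/negbTE xy wp]; rewrite [compile _]/=.
  split=> [/sat_ex1[v]|[k h]].
    move=> /sat_and[/sat_reach[k]]; rewrite /upd /= eqxx xy => -> h.
    by exists k; apply/IH.
  apply/sat_ex1; exists (e x ++ nseq k b); apply/sat_and; split; last exact/IH.
  by apply/sat_reach; exists k; rewrite /upd /= eqxx xy.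
- by move=> X p IH e E wp; split=> -[t h]; exists t; apply/(IH _ _ wp).
- by move=> X p IH e E wp; split=> h t; apply/(IH _ _ wp).
- move=> X p IH e E wp; apply: iff_trans (has_measure1P _ _) _.
  have -> // : [set t : tree | sat R e (upd E X t) (compile p)]%classic =
               [set t : tree | msat e (upd E X t) p]%classic.
  by apply/seteqP; split=> t h; apply/(IH _ _ wp).
Qed.

Definition MAnds (I : Type) (s : seq I) (f : I -> mform) :=
  foldr (fun i => MAnd (f i)) MTrue s.

Lemma msat_MAnds (I : eqType) (s : seq I) f e E :
  msat e E (MAnds s f) <-> forall i, i \in s -> msat e E (f i).
Proof.
elim: s => //= i s IH; split=> [[h /IH h'] j|h].
  by rewrite inE => /orP[/eqP->|/h'].
split; first by apply: h; rewrite mem_head.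
by apply/IH => j js; apply: h; rewrite inE js orbT.
Qed.

Lemma mwf_MAnds (I : eqType) (s : seq I) f :
  (forall i, i \in s -> mwf (f i)) -> mwf (MAnds s f).
Proof.
elim: s => //= i s IH h; rewrite h ?mem_head // IH // => j js.
by apply: h; rewrite inE js orbT.
Qed.

End macros.

(** * Comparison of the heights of columns *)

Section theta.
Local Open Scope nat_scope.

(** Round i is the vertex R^i, and its cell at time j is R^i L^(j+1). Variable 0 holds the root and
    variable 18 the first cell of the round. *)
Definition AllRound p := MRoot 0 (MAll true 0 1 p).
Definition AllCell r c p := MNext false r 18 (MAll false 18 c p).
Definition ExCell r c p := MNext false r 18 (MEx false 18 c p).

(* First-order variable 3 is a cell, and the set variables 2, 3, 4 are the selection
   of cells, the set of first rounds of groups and the random tree. *)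
Definition SubW w := MAll true 3 10 (MImp (MIn 10 w.+4.+4.+4.+4.+4) (MIn 10 4)).
Definition SubX x := MNext false 3 11 (MAll true 11 10
  (MImp (MIn 10 x.+4.+4.+4.+4.+4) (MIn 10 4))).
(** The group of a marked round 2 consists of the rounds 5 that come from it on and are not reached
    from a later marked round 7. Infinitely many groups must have all their selected cells satisfy
    [sub]. *)
Definition Groups sub := MAllP 4 (AllRound (MEx true 1 2 (MAnd (MIn 2 3) (MAll true 2 5
  (MImp (MNot (MNext true 2 6 (MEx true 6 7 (MAnd (MIn 7 3) (MReach true 7 5)))))
        (AllCell 5 3 (MImp (MIn 3 2) sub))))))).

(* The selection S has at most one cell per round, in infinitely many rounds. *)
Definition Theta w x := MAll2 2 (MImp
  (MAnd (AllRound (MEx true 1 2 (ExCell 2 3 (MIn 3 2))))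
        (AllRound (AllCell 1 3 (MImp (MIn 3 2)
          (MNext false 3 4 (MAll false 4 5 (MNot (MIn 5 2))))))))
  (MAnd (MAllP 4 (AllRound (MEx true 1 2 (ExCell 2 3
      (MAnd (MIn 3 2) (MAnd (SubW w) (SubX x)))))))
  (MAll2 3 (MImp (AllRound (MEx true 1 2 (MIn 2 3)))
    (MAnd (MImp (Groups (SubW w)) (Groups (SubX x)))
          (MImp (Groups (SubX x)) (Groups (SubW w)))))))).
Variable R : realType.

Definition cellv (r : vertex) j : vertex := rcons r false ++ nseq j false.

(** This and the following definitions have the shape to which [msat] unfolds, so that [theta] is
    convertible with the meaning of [Theta]. *)
Definition inf_from (P : vertex -> Prop) := forall m, exists k, P (nseq m true ++ nseq k true).

Definition subw (U t : tree) (c : vertex) :=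
  forall k, U (c ++ nseq k true) = true -> t (c ++ nseq k true) = true.

Definition subx (V t : tree) (c : vertex) :=
  forall k, V (rcons c false ++ nseq k true) = true -> t (rcons c false ++ nseq k true) = true.

Definition groups (G S : tree) (sub : vertex -> Prop) := inf_from (fun g =>
  G g = true /\ forall k,
    (~ exists a, G (rcons g true ++ nseq a true) = true /\
         exists b, g ++ nseq k true = (rcons g true ++ nseq a true) ++ nseq b true) ->
    forall j, S (cellv (g ++ nseq k true) j) = true -> sub (cellv (g ++ nseq k true) j)).

Definition theta (U V : tree) := forall S : tree,
  inf_from (fun r => exists j, S (cellv r j) = true) /\
  (forall i j, S (cellv (nseq i true) j) = true ->
     forall j', S (rcons (cellv (nseq i true) j) false ++ nseq j' false) <> true) ->
  {ae coin R, forall t, inf_from (fun r => exists j, S (cellv r j) = true /\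
      subw U t (cellv r j) /\ subx V t (cellv r j))} /\
  forall G : tree, inf_from (fun g => G g = true) ->
    ({ae coin R, forall t, groups G S (subw U t)} ->
     {ae coin R, forall t, groups G S (subx V t)}) /\
    ({ae coin R, forall t, groups G S (subx V t)} ->
     {ae coin R, forall t, groups G S (subw U t)}).

Lemma inf_fromP (P : vertex -> Prop) :
  inf_from P <-> forall m, exists2 i, m <= i & P (nseq i true).
Proof.
split=> h m.
  by have [k] := h m; rewrite -nseqD; exists (m + k); rewrite ?leq_addr.
by have [i mi Pi] := h m; exists (i - m); rewrite -nseqD subnKC.
Qed.

Lemma groupsP (G S : tree) (sub : vertex -> Prop) :
  groups G S sub <-> forall m, exists2 g, m <= g & G (nseq g true) = true /\
    forall i, g <= i -> (forall s, g < s <= i -> G (nseq s true) <> true) ->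
    forall j, S (cellv (nseq i true) j) = true -> sub (cellv (nseq i true) j).
Proof.
apply: iff_trans (inf_fromP _) _.
have nseqS g a : rcons (nseq g true) true ++ nseq a true = nseq (g.+1 + a) true.
  by rewrite nseqD -cats1 -(nseqD g 1) addn1.
split=> h m; have [g mg [Gg hg]] := h m; exists g; rewrite // Gg; split=> //.
  move=> i gi no j; rewrite -(subnKC gi) nseqD => Sj; apply: hg => // -[a [Ga [b]]].
  rewrite nseqS -!nseqD => /(congr1 size); rewrite !size_nseq => e.
  by move: Ga; rewrite nseqS; apply: no; lia.
move=> k no j Sj; rewrite -nseqD; apply: hg; rewrite ?leq_addr ?nseqD //.
move=> s /andP[gs si] Gs; apply: no; exists (s - g.+1); rewrite nseqS subnKC //; split=> //.
by exists (g + k - s); rewrite -!nseqD subnKC.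
Qed.

(** * Coordinates of the vertices in a round *)

Definition node i j k : vertex := cellv (nseq i true) j ++ nseq k true.

(** The length of the first run of R, the number of L after the first one, and what remains; on a
    [node] these are its coordinates. *)
Definition round_of (v : vertex) := find negb v.
Definition time_of (v : vertex) := find id (drop (round_of v).+1 v).
Definition level_of (v : vertex) := size v - (round_of v + time_of v).+1.

Lemma round_ofE i j k : round_of (node i j k) = i.
Proof. by rewrite /round_of /node /cellv; elim: i => //= i ->. Qed.

Lemma time_ofE i j k : time_of (node i j k) = j.
Proof.
rewrite /time_of round_ofE /node /cellv -catA drop_size_cat ?size_rcons ?size_nseq //.
by elim: j => [|j /= ->] //; case: k.
Qed.

Lemma level_ofE i j k : level_of (node i j k) = k.
Proof.
rewrite /level_of round_ofE time_ofE /node /cellv !size_cat size_rcons !size_nseq; lia.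
Qed.

Definition coords := (round_ofE, time_ofE, level_ofE).

Definition tree_of (f : nat -> nat -> nat -> bool) : tree :=
  fun v => f (round_of v) (time_of v) (level_of v).

Lemma tree_ofE f i j k : tree_of f (node i j k) = f i j k.
Proof. by rewrite /tree_of !coords. Qed.

Lemma cellE i j : cellv (nseq i true) j = node i j 0.
Proof. by rewrite /node cats0. Qed.

Lemma cellS i j : rcons (cellv (nseq i true) j) false = cellv (nseq i true) j.+1.
Proof. exact: rcons_cat_nseq. Qed.

Definition block i j n := [seq node i j k | k <- iota 0 n].

Lemma size_block i j n : size (block i j n) = n.
Proof. by rewrite size_map size_iota. Qed.

Lemma uniq_block i j n : uniq (block i j n).
Proof.
rewrite map_inj_uniq ?iota_uniq // => k k' /(congr1 level_of).
by rewrite !coords.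
Qed.

Lemma mem_block i j n v : v \in block i j n -> round_of v = i /\ time_of v = j.
Proof. by case/mapP=> k _ ->; rewrite !coords. Qed.

Lemma ones_block i j n (t : tree) :
  ones (block i j n) t <-> forall k, k < n -> t (node i j k) = true.
Proof.
split=> [h k kn|h v /mapP[k]]; first by apply/h/map_f; rewrite mem_iota.
by rewrite mem_iota => kn ->; apply: h.
Qed.

Lemma subwP (U t : tree) i j n : (forall k, U (node i j k) = (k < n)) ->
  subw U t (cellv (nseq i true) j) <-> ones (block i j n) t.
Proof.
move=> hU; apply: iff_trans (iff_sym (ones_block _ _ _ _)).
by split=> h k hk; apply: h; move: hk; rewrite -hU.
Qed.

Lemma subxP (V t : tree) i j n : (forall k, V (node i j.+1 k) = (k < n)) ->
  subx V t (cellv (nseq i true) j) <-> ones (block i j.+1 n) t.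
Proof.
move=> hV; apply: iff_trans (subwP t hV).
by rewrite /subx cellS.
Qed.

Lemma uniq_flatten_rounds (B : nat -> seq vertex) s : (forall i, uniq (B i)) ->
  (forall i v, v \in B i -> round_of v = i) -> uniq s -> uniq (flatten [seq B i | i <- s]).
Proof.
move=> Bu Br; elim: s => //= i s IH /andP[is_ us]; rewrite cat_uniq Bu IH // andbT /=.
apply/hasPn => v /flatten_mapP[j js vj]; apply/negP => vi.
by move: is_; rewrite -(Br _ _ vi) (Br _ _ vj) js.
Qed.

Lemma ones_flatten (I : eqType) (B : I -> seq vertex) (s : seq I) (t : tree) :
  ones (flatten [seq B i | i <- s]) t <-> forall i, i \in s -> ones (B i) t.
Proof.
split=> [h i is_ v vi|h v /flatten_mapP[i is_ vi]]; last exact: h is_ v vi.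
by apply: h; apply/flatten_mapP; exists i.
Qed.

End theta.

(** * Divergent and bounded sums *)

Section sums.
Local Open Scope ring_scope.
Variable R : realType.

Definition infinite (I : nat -> Prop) := forall m, exists2 i, (m <= i)%N & I i.

Lemma sum_infinite (I : nat -> Prop) (p : nat -> R) (eps : R) : infinite I -> 0 < eps ->
  (forall i, 0 <= p i) -> (forall i, I i -> eps <= p i) ->
  forall C, exists n, C <= \sum_(i < n) p i.
Proof.
move=> inf e0 p0 pI C.
have step N : exists n, N%:R * eps <= \sum_(i < n) p i.
  elim: N => [|N [n IH]]; first by exists 0%N; rewrite mul0r big_ord0.
  have [i ni Ii] := inf n; exists i.+1; rewrite big_ord_recr /=.
  have : \sum_(i < n) p i <= \sum_(i < i) p i.
    rewrite -!(big_mkord xpredT) [leRHS](@big_cat_nat _ _ _ n) //=.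
    by rewrite lerDl sumr_ge0.
  have := pI _ Ii; rewrite -natr1 mulrDl mul1r; lra.
have [n hn] := step (Num.truncn (C / eps)).+1; exists n; apply: le_trans hn.
by rewrite -ler_pdivrMr // ltW // truncnS_gt.
Qed.

Lemma infinite_pigeonhole (I : nat -> Prop) (h : nat -> nat) N : infinite I ->
  (forall i, I i -> (h i < N)%N) -> exists r, infinite (fun i => I i /\ h i = r).
Proof.
elim: N I => [|N IH] I inf hN; first by have [i _ /hN] := inf 0%N.
have [|no] := pselect (infinite (fun i => I i /\ h i = N)); first by exists N.
have [m hm] : exists m, forall i, (m <= i)%N -> I i -> h i <> N.
  apply: contrapT => no'; apply: no => m; apply: contrapT => no.
  by apply: no'; exists m => i mi Ii hi; apply: no; exists i.
have [||r hr] := IH (fun i => I i /\ (m <= i)%N).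
- move=> k; have [i ki Ii] := inf (maxn m k); exists i; first by lia.
  by split=> //; lia.
- by move=> i [Ii mi]; have := hN _ Ii; have := hm _ mi Ii; lia.
by exists r => k; have [i ki [[Ii _] hi]] := hr k; exists i.
Qed.

(* If v tends to infinity along I, we keep an element i of I when v i is at least
   the number of elements kept before i. *)
Lemma sparse_subset (I : pred nat) (v : nat -> nat) : infinite I ->
  (forall M, ~ infinite (fun i => I i /\ (v i <= M)%N)) ->
  exists J : pred nat, [/\ forall i, J i -> I i, infinite J &
    forall n, \sum_(i < n) (if J i then (2^-1) ^+ v i else 0) <= 2 :> R].
Proof.
move=> inf no.
pose cnt := fix cnt n := if n is n'.+1 then ((I n' && (cnt n' <= v n')) + cnt n')%N else 0%N.
pose J i := I i && (cnt i <= v i)%N.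
have cntS n : cnt n.+1 = (J n + cnt n)%N by [].
exists J; split; first by move=> i /andP[].
(* If nothing were kept from [m] on, the count would stay at [cnt m], which [v] eventually exceeds
   along [I]. *)
- move=> m; have [k hk] : exists k, forall i, (k <= i)%N -> I i -> (cnt m < v i)%N.
    apply: contrapT => no'; apply: (no (cnt m)) => k; apply: contrapT => no1.
    apply: no'; exists k => i ki Ii; rewrite ltnNge; apply/negP => vi.
    by apply: no1; exists i.
  apply: contrapT => none.
  have cst i : (m <= i)%N -> cnt i = cnt m.
    move=> mi; rewrite -(subnKC mi); elim: (i - m)%N => [|d IH]; first by rewrite addn0.
    rewrite addnS cntS IH; case: (boolP (J _)) => // h.
    by case: none; exists (m + d)%N; rewrite ?leq_addr.
  have [i ki Ii] := inf (maxn m k).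
  case: none; exists i; first by lia.
  rewrite /J Ii cst; last by lia.
  by apply/ltnW/hk => //; lia.
(* An element kept when the count is [c] adds at most [2^-c], exactly the increase of the right-hand
   side. *)
- suff h n : \sum_(i < n) (if J i then (2^-1) ^+ v i else 0) <= 2 - 2 * (2^-1) ^+ cnt n :> R.
    move=> n; apply: le_trans (h n) _.
    by rewrite lerBlDr lerDl mulr_ge0 // exprn_ge0 // invr_ge0.
  elim: n => [|n IH]; first by rewrite big_ord0 expr0; lra.
  rewrite big_ord_recr cntS /=; case: ifP => Jn /=; last by rewrite addr0.
  have : (2^-1) ^+ v n <= (2^-1) ^+ cnt n :> R.
    case/andP: Jn => _ h; apply: ler_wiXn2l h; first by rewrite invr_ge0.
    by rewrite invf_le1 ?ler1n.
  rewrite add1n exprS; lra.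
Qed.

(* Group sizes: the size k occurs 2^(x*k) times, so that the terms 2^-(x*k) sum
   to 1 over these groups, and the terms 2^-(y*k) to at most 2^-k. *)
Lemma group_sizes (x y : nat) : (x < y)%N -> exists s : nat -> nat,
  [/\ forall t, (0 < s t)%N,
      forall C : R, exists n, C <= \sum_(i < n) (2^-1) ^+ (x * s i) &
      forall n, \sum_(i < n) (2^-1) ^+ (y * s i) <= 2 :> R].
Proof.
move=> xy.
(* In state [(k, u)] the current group has size [k] and is preceded by [u] groups of that size. *)
pose next (c : nat * nat) :=
  if (c.2.+1 < 2 ^ (x * c.1))%N then (c.1, c.2.+1) else (c.1.+1, 0%N).
pose st n := iter n next (1, 0)%N.
have stS n : st n.+1 = next (st n) by [].
have st_lt n : ((st n).2 < 2 ^ (x * (st n).1))%N.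
  elim: n => [|n IH]; first by rewrite expn_gt0.
  by rewrite stS /next; case: ifP => //=; rewrite expn_gt0.
have stage k : exists n, st n = (k.+1, 0)%N.
  elim: k => [|k [n hn]]; first by exists 0%N.
  have run u : (u < 2 ^ (x * k.+1))%N -> st (n + u)%N = (k.+1, u).
    elim: u => [|u IH] hu; first by rewrite addn0.
    by rewrite addnS stS (IH (ltnW hu)) /next hu.
  exists (n + (2 ^ (x * k.+1)).-1).+1; rewrite stS run ?prednK ?expn_gt0 //.
  by rewrite /next /= prednK ?expn_gt0 // ltnn.
have twoE z : (2 ^ z)%:R * (2^-1) ^+ z = 1 :> R.
  by rewrite natrX exprVn divff // expf_neq0.
exists (fun t => (st t).1); split.
- by move=> t; elim: t => // t IH; rewrite stS /next; case: ifP.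
(* Each completed size has contributed exactly 1. *)
- have sumE n : \sum_(i < n) (2^-1) ^+ (x * (st i).1) =
      (st n).1%:R - 1 + (st n).2%:R * (2^-1) ^+ (x * (st n).1) :> R.
    elim: n => [|n IH]; first by rewrite big_ord0 subrr mul0r addr0.
    rewrite big_ord_recr /= IH -/(st n); have := st_lt n; rewrite /next.
    case: (st n) => k u /=; case: (ltnP u.+1) => hu hu' /=.
      by rewrite -[u.+1%:R]natr1 mulrDl mul1r addrA.
    have e : (u%:R + 1) * (2^-1) ^+ (x * k) = 1 :> R.
      by rewrite natr1 (_ : u.+1 = 2 ^ (x * k))%N ?twoE //; lia.
    by move: e; rewrite mulrDl mul1r mul0r addr0 -[k.+1%:R]natr1; lra.
  move=> C; have [n hn] := stage (Num.truncn C).+1; exists n.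
  by rewrite sumE hn mul0r addr0 -[(_.+2)%:R]natr1 addrK ltW // truncnS_gt.
(* As [x.+1 <= y], a completed size [k] has contributed at most [2^-k]. *)
- have le_sum n : \sum_(i < n) (2^-1) ^+ (y * (st i).1) <=
      2 - 2 * (2^-1) ^+ (st n).1 + (st n).2%:R * (2^-1) ^+ (x.+1 * (st n).1) :> R.
    elim: n => [|n IH]; first by rewrite big_ord0 mul0r expr1; lra.
    rewrite big_ord_recr /=; have := st_lt n; rewrite /next.
    have : (2^-1) ^+ (y * (st n).1) <= (2^-1) ^+ (x.+1 * (st n).1) :> R.
      apply: ler_wiXn2l; rewrite ?invr_ge0 ?invf_le1 ?ler1n //.
      by rewrite leq_mul2r xy orbT.
    move: IH; rewrite -/(st n); case: (st n) => k u /=; case: (ltnP u.+1) => hu IH hy hu' /=.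
      by rewrite -[u.+1%:R]natr1 mulrDl mul1r; lra.
    have e : (u%:R + 1) * (2^-1) ^+ (x.+1 * k) = (2^-1) ^+ k :> R.
      rewrite natr1 mulSn exprD mulrCA (_ : u.+1 = 2 ^ (x * k))%N; last by lia.
      by rewrite twoE mulr1.
    by move: e; rewrite mulrDl mul1r mul0r addr0 exprS; lra.
  move=> n; apply: le_trans (le_sum n) _; rewrite mulSn exprD.
  have := st_lt n; case: (st n) => k u /= hu.
  have : u%:R * (2^-1) ^+ (x * k) <= 1 :> R.
    by rewrite -[leRHS](twoE (x * k)%N) ler_wpM2r ?exprn_ge0 ?invr_ge0 // ler_nat ltnW.
  have : 0 <= (2^-1) ^+ k :> R by rewrite exprn_ge0 // invr_ge0.
  by set p := (2^-1) ^+ k; set q := _ ^+ _; move: (u%:R) => w; nra.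
Qed.

End sums.

(** * The comparison of consecutive columns by [theta] *)

Section theta_proofs.
Local Open Scope nat_scope.
Variable R : realType.

Lemma ae_imply (P Q : tree -> Prop) : (forall t, P t -> Q t) ->
  {ae coin R, forall t, P t} -> {ae coin R, forall t, Q t}.
Proof. by move=> PQ; apply: negligibleS => t /= nQ Pt; apply/nQ/PQ. Qed.

Definition good_family (I : pred nat) (F : nat -> seq vertex) :=
  (forall i, I i -> uniq (F i)) /\
  (forall i j v, I i -> I j -> v \in F i -> v \in F j -> i = j).

(** By the two Borel-Cantelli lemmas, whether the event is almost sure depends only on the
    divergence of a sum determined by the sizes. *)
Lemma ae_infinitely_often_size (I : pred nat) (F F' : nat -> seq vertex) :
  good_family I F -> good_family I F' -> (forall i, I i -> size (F i) = size (F' i)) ->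
  {ae coin R, forall t, infinitely_often I F t} ->
  {ae coin R, forall t, infinitely_often I F' t}.
Proof.
move=> [uF dF] [uF' dF'] sz aeF; apply: ae_infinitely_often => //.
pose s n : R := (\sum_(i < n) (if I i then (2^-1) ^+ size (F i) else 0))%R.
have [C|[C hC]] : (forall C, exists n, (C <= s n)%R) \/ exists C, forall n, (s n <= C)%R.
  have [h|h] := pselect (forall C, exists n, (C <= s n)%R); [by left|right].
  have [C hC] : exists C, ~ exists n, (C <= s n)%R.
    by apply: contrapT => h'; apply: h => C; apply: contrapT => h; apply: h'; exists C.
  exists C => n; rewrite leNgt; apply/negP => /ltW hn.
  by apply: hC; exists n.
- move=> D; have [n hn] := C D; exists n; apply: le_trans hn _.
  by apply: ler_sum => i _; case: ifP => // Ii; rewrite sz.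
- by case: (not_ae_infinitely_often (C := C) uF _ aeF).
Qed.

(** [U] holds the expected heights [a] and [V] the actual heights [b]; a cell is free of error when
    [a i j = b i j.+1]. *)
Variables (U V : tree) (a b : nat -> nat -> nat).
Hypothesis hU : forall i j k, U (node i j k) = (k < a i j).
Hypothesis hV : forall i j k, V (node i j k) = (k < b i j).

Let blkU i j := block i j (a i j).
Let blkV i j := block i j.+1 (b i j.+1).

Lemma subU i j t : subw U t (cellv (nseq i true) j) <-> ones (blkU i j) t.
Proof. exact: subwP. Qed.

Lemma subV i j t : subx V t (cellv (nseq i true) j) <-> ones (blkV i j) t.
Proof. exact: subxP. Qed.

Lemma good_pairs (I : pred nat) f : good_family I (fun i => blkU i (f i) ++ blkV i (f i)).
Proof.
split=> [i _|i j v _ _].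
  rewrite cat_uniq !uniq_block /= andbT; apply/hasPn => v /mem_block[_ e].
  by apply/negP => /mem_block[_]; rewrite e; lia.
by rewrite !mem_cat => /orP[]/mem_block[<- _] /orP[]/mem_block[<- _].
Qed.

(** Bounded heights keep the probabilities of the selected pairs of columns above a positive
    constant, so infinitely many pairs occur almost surely. Equal heights give the two unions over
    each group the same size, and [ae_infinitely_often_size] applies both ways. *)
Lemma theta_correct : (forall i j, a i j = b i j.+1) ->
  (exists M, forall i j, a i j <= M) -> theta R U V.
Proof.
move=> ab [M aM] S [/inf_fromP infS one].
have oneS i j j' :
    S (cellv (nseq i true) j) = true -> S (cellv (nseq i true) j') = true -> j = j'.
  (* The hypothesis [one] excludes a selected cell at a later time of the same round. *)
  have lt_no k k' : k < k' ->
      S (cellv (nseq i true) k) = true -> S (cellv (nseq i true) k') <> true.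
    move=> kk' /one/(_ (k' - k.+1)); rewrite cellS /cellv -catA -nseqD.
    by rewrite subnKC.
  by case: (ltngtP j j') => // /lt_no h /h.
pose I i := `[< exists j, S (cellv (nseq i true) j) = true >].
have [f hf] : exists f, forall i, I i -> S (cellv (nseq i true) (f i)) = true.
  have /choice[f hf] i : exists j, I i -> S (cellv (nseq i true) j) = true.
    by have [/asboolP[j Sj]|] := boolP (I i); [exists j|exists 0].
  by exists f.
have fE i j : S (cellv (nseq i true) j) = true -> I i /\ j = f i.
  move=> Sj; have Ii : I i by apply/asboolP; exists j.
  by split=> //; apply: oneS Sj (hf _ Ii).
split.
  have [gu gd] := good_pairs I f.
  apply: (ae_imply _ (ae_infinitely_often (R := R) gu gd _)).
    move=> t h; apply/inf_fromP => m; have [i mi [Ii]] := h m.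
    rewrite ones_cat; case=> o1 o2; exists i => //; exists (f i); split; first exact: hf.
    by split; [apply/subU|apply/subV].
  apply: (@sum_infinite R I
    (fun i => if I i then (2^-1) ^+ size (blkU i (f i) ++ blkV i (f i)) else 0)%R
    ((2^-1) ^+ (M + M))%R).
  - by move=> m; have [i mi [j Sj]] := infS m; exists i => //; apply/asboolP; exists j.
  - by rewrite exprn_gt0 // invr_gt0.
  - by move=> i; case: ifP => // _; rewrite exprn_ge0 // invr_ge0.
  - move=> i Ii; rewrite ifT //; apply: ler_wiXn2l; rewrite ?invr_ge0 ?invf_le1 ?ler1n //.
    by rewrite size_cat !size_block -ab leq_add.
move=> G /inf_fromP infG.
(* [nx g] is the first marked round after [g], so the group of [g] is the interval [gr g] that ends
   before [nx g]. *)
have /choice[nx hnx] g : exists n, [/\ g < n, G (nseq n true) = true &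
    forall s, g < s < n -> G (nseq s true) <> true].
  have ex : exists n, (g < n) && G (nseq n true).
    by have [n gn Gn] := infG g.+1; exists n; rewrite gn Gn.
  case: (ex_minnP ex) => n /andP[gn Gn] min_n; exists n; split=> // s /andP[gs sn] Gs.
  by have := min_n s; rewrite gs Gs => /(_ isT); lia.
pose gr g := iota g (nx g - g).
have mem_gr g i : (i \in gr g) = (g <= i < nx g).
  by rewrite mem_iota; have [h _ _] := hnx g; rewrite subnKC // ltnW.
pose sel (B : nat -> nat -> seq vertex) i := if I i then B i (f i) else [::].
pose FF B g := flatten [seq sel B i | i <- gr g].
pose GG i := G (nseq i true) : bool.
have event (B : nat -> nat -> seq vertex) (sub : tree -> vertex -> Prop) t :
    (forall i j, sub t (cellv (nseq i true) j) <-> ones (B i j) t) ->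
    groups G S (sub t) <-> infinitely_often GG (FF B) t.
  move=> hB; apply: iff_trans (groupsP _ _ _) _.
  split=> h m; have [g mg [Gg hg]] := h m; exists g => //; split=> //.
    apply/ones_flatten => i; rewrite mem_gr => /andP[gi inx].
    have [_ _ no] := hnx g.
    rewrite /sel; case: ifP => // Ii; apply/hB/hg => //; last exact: hf.
    by move=> s /andP[gs si]; apply: no; lia.
  move=> i gi no j /fE[Ii ->]; apply/hB.
  move/ones_flatten: hg => /(_ i); rewrite /sel Ii; apply.
  rewrite mem_gr gi ltnNge; apply/negP => nxi.
  have [gn Gn _] := hnx g; apply: (no (nx g)) => //; lia.
have good (B : nat -> nat -> seq vertex) : (forall i j, uniq (B i j)) ->
    (forall i j v, v \in B i j -> round_of v = i) -> good_family GG (FF B).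
  move=> uB rB.
  have rs i v : v \in sel B i -> round_of v = i by rewrite /sel; case: ifP => // _ /rB.
  split=> [g _|g g' v Gg Gg' /flatten_mapP[i ig vi] /flatten_mapP[i' ig' vi']].
    by apply: uniq_flatten_rounds => // [i|]; [rewrite /sel; case: ifP|exact: iota_uniq].
  move: ig ig'; rewrite !mem_gr -(rs _ _ vi) -(rs _ _ vi').
  have [_ _ no] := hnx g; have [_ _ no'] := hnx g'.
  case: (ltngtP g g') => // gg' r r'; exfalso.
    by apply: (no g' _ Gg'); lia.
  by apply: (no' g _ Gg); lia.
have gU : good_family GG (FF blkU).
  by apply: good => [i j|i j v /mem_block[]] //; exact: uniq_block.
have gV : good_family GG (FF blkV).
  by apply: good => [i j|i j v /mem_block[]] //; exact: uniq_block.
have sz g : size (FF blkU g) = size (FF blkV g).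
  rewrite /FF !size_flatten /shape -!map_comp; congr (sumn _); apply: eq_map => i /=.
  by rewrite /sel; case: ifP => // _; rewrite !size_block ab.
have evU t := event blkU (subw U) t (fun i j => subU i j t).
have evV t := event blkV (subx V) t (fun i j => subV i j t).
split=> h.
  apply: ae_imply (fun t => iffRL (evV t)) _.
  apply: ae_infinitely_often_size gU gV (fun g _ => sz g) _.
  by apply: ae_imply h => t /evU.
apply: ae_imply (fun t => iffRL (evU t)) _.
apply: ae_infinitely_often_size gV gU (fun g _ => esym (sz g)) _.
by apply: ae_imply h => t /evV.
Qed.

(* The rounds with a selected cell are e 0 < e 1 < ..., and the t-th group consists
   of the rounds e q with o t <= q < o t.+1. *)
Lemma groups_enum (e o : nat -> nat) (f : nat -> nat) (S G : tree)
    (sub : vertex -> Prop) (Q : nat -> Prop) :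
  {homo e : i j / i < j} -> {homo o : i j / i < j} ->
  (forall i j, S (node i j 0) = true <-> (exists q, i = e q) /\ j = f i) ->
  (forall i, G (nseq i true) = true <-> exists t, i = e (o t)) ->
  (forall i, sub (node i (f i) 0) <-> Q i) ->
  groups G S sub <-> forall m, exists2 t, m <= t & forall q, o t <= q < o t.+1 -> Q (e q).
Proof.
move=> e_mono o_mono hS hG hQ; apply: iff_trans (groupsP _ _ _) _.
have ltE (h : nat -> nat) : {homo h : i j / i < j} -> forall i j, (h i < h j) = (i < j).
  move=> hh i j; case: (ltngtP i j) => [/hh|/hh|->]; rewrite ?ltnn //.
  by move=> ?; apply/negbTE; rewrite -leqNgt ltnW.
have leE (h : nat -> nat) : {homo h : i j / i < j} -> forall i j, (h i <= h j) = (i <= j).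
  by move=> hh i j; rewrite leqNgt ltE // -leqNgt.
have ge_id (h : nat -> nat) : {homo h : i j / i < j} -> forall i, i <= h i.
  by move=> hh; elim=> // i IH; apply: leq_ltn_trans IH (hh _ _ _).
split=> h m.
  have [g mg [/hG[t gt] hg]] := h (e (o m)); exists t.
    by move: mg; rewrite gt !leE.
  move=> q /andP[tq qt]; apply/hQ; rewrite -cellE; apply: hg; rewrite ?gt ?leE //.
    move=> s /andP[+ +] /hG[t' st']; rewrite st' (ltE e) // (leE e) // (ltE o) // => tt' t'q.
    by move: (leq_ltn_trans t'q qt); rewrite (ltE o) // ltnS leqNgt tt'.
  by rewrite cellE; apply/hS; split=> //; exists q.
have [t mt ht] := h m; exists (e (o t)).
  by rewrite (leq_trans mt) // (leq_trans (ge_id _ o_mono t)) // ge_id.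
split; first by apply/hG; exists t.
move=> i ti no j; rewrite cellE => /hS[[q iq] ->]; apply/hQ.
rewrite iq; apply: ht; move: ti; rewrite iq (leE e) // => -> /=; rewrite ltnNge.
apply/negP => tq; apply: (no (e (o t.+1))); last by apply/hG; exists t.+1.
by rewrite iq (ltE e) // (leE e) // tq o_mono.
Qed.

(** The rounds [e q] are distinct, so the [s t] blocks of a group are disjoint and their sizes add
    up. *)
Lemma group_weight (e o s : nat -> nat) (B : nat -> seq vertex) (n : nat) :
  {homo e : i j / i < j} -> (forall t, o t.+1 = o t + s t) -> o 0 = 0 ->
  (forall t, 0 < s t) ->
  (forall q, uniq (B q) /\ size (B q) = n) -> (forall q v, v \in B q -> round_of v = e q) ->
  exists F : nat -> seq vertex, [/\ good_family xpredT F,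
    forall t, size (F t) = n * s t &
    forall t (y : tree), ones (F t) y <-> forall q, o t <= q < o t.+1 -> ones (B q) y].
Proof.
move=> e_mono oS o0 s0 uB rB.
have e_inj : injective e.
  by move=> i j; case: (ltngtP i j) => // /e_mono; lia.
have o_le : {homo o : i j / i <= j}.
  move=> i j ij; rewrite -(subnKC ij); elim: (j - i) => [|d IH]; first by rewrite addn0.
  by rewrite addnS oS; lia.
have mem_o t q : (q \in iota (o t) (s t)) = (o t <= q < o t.+1) by rewrite mem_iota oS.
exists (fun t => flatten [seq B q | q <- iota (o t) (s t)]); split.
- split=> [t _|t t' v _ _ /flatten_mapP[q qt vq] /flatten_mapP[q' qt' vq']].
    have := iota_uniq (o t) (s t); elim: (iota _ _) => //= q l IH /andP[ql ul].
    rewrite cat_uniq (proj1 (uB q)) IH // andbT /=.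
    apply/hasPn => v /flatten_mapP[j jl vj]; apply/negP => vi.
    by move: ql; rewrite (e_inj q j) ?jl // -(rB _ _ vi) (rB _ _ vj).
  have qq' : q = q' by apply: e_inj; rewrite -(rB _ _ vq) (rB _ _ vq').
  move: qt qt'; rewrite !mem_o qq'; case: (ltngtP t t') => // tt'.
    by have := o_le _ _ tt'; lia.
  by have := o_le _ _ tt'; lia.
- move=> t; rewrite -[in RHS](size_iota (o t) (s t)).
  elim: (iota _ _) => [|q l IH]; first by rewrite muln0.
  by rewrite /= size_cat IH (proj2 (uB q)) mulnS.
- move=> t y; apply: iff_trans (ones_flatten _ _ _) _.
  by split=> h q; have := h q; rewrite mem_o.
Qed.

(** Two selections are used: a sparse one to bound the heights at infinitely many errors, then one
    with a constant pair of heights, grouped so that only one of the two sums diverges. *)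
Lemma theta_error (f : nat -> nat) (I : pred nat) : infinite I ->
  (forall i, I i -> a i (f i) <> b i (f i).+1) -> ~ theta R U V.
Proof.
move=> infI err th.
pose v i := a i (f i) + b i (f i).+1.
(* Selecting the cell of time [f i] in each round [i] of an infinite [J] satisfies the premises of
   [theta]. *)
have thS (J : pred nat) : infinite J ->
    let S := tree_of (fun i j k => [&& J i, j == f i & k == 0]) in
    [/\ forall i j, S (node i j 0) = true <-> J i /\ j = f i,
      inf_from (fun r => exists j, S (cellv r j) = true) &
      forall i j, S (cellv (nseq i true) j) = true ->
        forall j', S (rcons (cellv (nseq i true) j) false ++ nseq j' false) <> true].
  move=> infJ S.
  have hS i j : S (node i j 0) = true <-> J i /\ j = f i.
    rewrite /S tree_ofE eqxx andbT; split=> [/andP[-> /eqP]|[-> ->]] //.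
    by rewrite eqxx.
  split=> //.
    apply/inf_fromP => m; have [i mi Ji] := infJ m; exists i => //.
    by exists (f i); rewrite cellE; apply/hS.
  move=> i j Sj j'; rewrite cellS /cellv -catA -nseqD -/(cellv (nseq i true) (j.+1 + j')) cellE.
  by move=> /hS[_ e]; move: Sj; rewrite cellE => /hS[_]; lia.
(* Otherwise [sparse_subset] yields a selection whose pairs of columns have a bounded sum, against
   the first conclusion of [theta]. *)
have [M infM] : exists M, infinite (fun i => I i /\ v i <= M).
  apply: contrapT => no.
  have [|J [JI infJ hJ]] := sparse_subset R infI (v := v).
    by move=> M hM; apply: no; exists M.
  have [hS infS oneS] := thS J infJ; have [ae _] := th _ (conj infS oneS).
  have [gu gd] := good_pairs J f.
  apply: (not_ae_infinitely_often (R := R) (C := 2) gu).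
    move=> n; apply: le_trans (hJ n); apply: ler_sum => i _; case: ifP => // _.
    by rewrite size_cat !size_block.
  apply: ae_imply ae => t /inf_fromP h m; have [i mi [j [Sj [hu hv]]]] := h m.
  move: Sj hu hv; rewrite cellE => /hS[Ji ->]; rewrite -cellE => /subU hu /subV hv.
  by exists i => //; split=> //; rewrite ones_cat.
have [|x /infinite_pigeonhole inf1] :=
    infinite_pigeonhole (h := fun i => a i (f i)) (N := M.+1) infM.
  by move=> i [_]; rewrite /v ltnS; apply: leq_trans; exact: leq_addr.
have {inf1}[|y inf2] := inf1 (fun i => b i (f i).+1) M.+1.
  by move=> i [[_ +] _]; rewrite /v ltnS; apply: leq_trans; exact: leq_addl.
have xy : x != y.
  by have [i _ [[[Ii _] <-] <-]] := inf2 0; apply/eqP/err.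
have /choice[nx hnx] m : exists i, m <= i /\ (a i (f i) = x /\ b i (f i).+1 = y).
  by have [i mi [[_ ax] bx]] := inf2 m; exists i.
(* [e] enumerates rounds where the expected height is [x] and the actual one [y]. *)
pose e := fix e n := if n is n'.+1 then nx (e n').+1 else nx 0.
have e_mono : {homo e : i j / i < j}.
  by apply: homo_ltn => [? ? ? |i]; [exact: ltn_trans|have [] := hnx (e i).+1].
have eP q : a (e q) (f (e q)) = x /\ b (e q) (f (e q)).+1 = y.
  by case: q => [|q]; [have [] := hnx 0|have [] := hnx (e q).+1].
pose J i := `[< exists q, i = e q >].
have infJ : infinite J.
  move=> m; exists (e m); last by apply/asboolP; exists m.
  by elim: m => // m IH; apply: leq_ltn_trans IH (e_mono _ _ _).
have [hS infS oneS] := thS J infJ; set S := tree_of _ in hS infS oneS.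
have [_ thG] := th S (conj infS oneS).
have hS' i j : S (node i j 0) = true <-> (exists q, i = e q) /\ j = f i.
  by split=> [/hS[/asboolP]|[]] // h ->; apply/hS; split=> //; apply/asboolP.
(* Minimum and maximum treat both orders of [x] and [y] at once. *)
have lt_xy : minn x y < maxn x y by lia.
have [s [s0 div bd]] := group_sizes R lt_xy.
pose o t := \sum_(i < t) s i.
have oS t : o t.+1 = o t + s t by rewrite /o big_ord_recr.
have o_mono : {homo o : i j / i < j}.
  apply: homo_ltn => [? ? ?|i]; first exact: ltn_trans.
  by rewrite oS -[ltnLHS]addn0 ltn_add2l.
have o0 : o 0 = 0 by rewrite /o big_ord0.
pose G : tree := fun w => `[< exists t, w = nseq (e (o t)) true >].
have hG i : G (nseq i true) = true <-> exists t, i = e (o t).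
  split=> [/asboolP[t /(congr1 size)]|[t ->]]; first by rewrite !size_nseq; exists t.
  by apply/asboolP; exists t.
have infG : inf_from (fun g => G g = true).
  apply/inf_fromP => m; exists (e (o m)); last by apply/hG; exists m.
  have ge_id (h : nat -> nat) : {homo h : i j / i < j} -> forall i, i <= h i.
    by move=> hh; elim=> // i IH; apply: leq_ltn_trans IH (hh _ _ _).
  exact: leq_trans (ge_id _ o_mono m) (ge_id _ e_mono _).
have {thG}[thUV thVU] := thG G infG.
have ev (B : nat -> nat -> seq vertex) (sub : tree -> vertex -> Prop) n :
    (forall i j t, sub t (cellv (nseq i true) j) <-> ones (B i j) t) ->
    (forall i j, uniq (B i j)) -> (forall i j w, w \in B i j -> round_of w = i) ->
    (forall q, size (B (e q) (f (e q))) = n) ->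
    exists F : nat -> seq vertex, [/\ good_family xpredT F, forall t, size (F t) = n * s t &
      forall t, groups G S (sub t) <-> infinitely_often xpredT F t].
  move=> hB uB rB sB.
  have [q|q w /rB //|F [gF sF oF]] :=
      @group_weight e o s (fun q => B (e q) (f (e q))) n e_mono oS o0 s0.
    by split; [exact: uB|exact: sB].
  exists F; split=> // t.
  apply: iff_trans (groups_enum (Q := fun i => ones (B i (f i)) t) e_mono o_mono hS' hG _) _.
    by move=> i; rewrite -cellE.
  split=> h m; have [k mk hk] := h m; exists k => //.
    by split=> //; apply/oF.
  by case: hk => _ /oF.
(* The family of the smaller height has the divergent sum and that of the larger height the bounded
   one, so the implication between them fails. *)
have no (n1 n2 : nat) (F1 F2 : nat -> seq vertex) : n1 = minn x y -> n2 = maxn x y ->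
    good_family xpredT F1 -> good_family xpredT F2 ->
    (forall t, size (F1 t) = n1 * s t) -> (forall t, size (F2 t) = n2 * s t) ->
    ({ae coin R, forall t, infinitely_often xpredT F1 t} ->
     {ae coin R, forall t, infinitely_often xpredT F2 t}) -> False.
  move=> -> -> [u1 d1] [u2 d2] s1 s2 h.
  apply: (not_ae_infinitely_often (R := R) (C := 2) u2) (h _).
    by move=> n; apply: le_trans (bd n); apply: ler_sum => i _; rewrite s2.
  apply: ae_infinitely_often => // C; have [n hn] := div C; exists n.
  by apply: le_trans hn _; apply: ler_sum => i _; rewrite s1.
have [||||F [gF sF eF]] := ev blkU (subw U) x.
- by move=> i j t; exact: subU.
- by move=> i j; exact: uniq_block.
- by move=> i j w /mem_block[].
- by move=> q; rewrite size_block; case: (eP q).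
have [||||F' [gF' sF' eF']] := ev blkV (subx V) y.
- by move=> i j t; exact: subV.
- by move=> i j; exact: uniq_block.
- by move=> i j w /mem_block[].
- by move=> q; rewrite size_block; case: (eP q).
case: (ltngtP x y) xy => // lxy _.
  apply: (no x y F F') => //; rewrite ?(minn_idPl (ltnW lxy)) ?(maxn_idPr (ltnW lxy)) //.
  move=> h; apply: ae_imply (fun t => iffLR (eF' t)) (thUV _).
  exact: ae_imply (fun t => iffRL (eF t)) h.
apply: (no y x F' F) => //; rewrite ?(minn_idPr (ltnW lxy)) ?(maxn_idPl (ltnW lxy)) //.
move=> h; apply: ae_imply (fun t => iffLR (eF t)) (thVU _).
exact: ae_imply (fun t => iffRL (eF' t)) h.
Qed.

End theta_proofs.

(** * Register machines *)

Section machines.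
Local Open Scope nat_scope.

(** [While r a] decrements [r] before each run of [a]. As [wf_com] forbids [a] to write [r], it is a
    for loop, and programs have a total denotation. *)
Inductive com := Skip | Incr (r : nat) | Seq (a b : com) | While (r : nat) (a : com).

(* z is a register that contains 0, used for unconditional jumps *)
Fixpoint comp (z off : nat) (c : com) : seq instr :=
  match c with
  | Skip => [::]
  | Incr r => [:: Inc r]
  | Seq a b => let ca := comp z off a in ca ++ comp z (off + size ca) b
  | While r a => let ca := comp z off.+1 a in
      Dec r (off + (size ca).+2) :: rcons ca (Dec z off)
  end.

Fixpoint writes (c : com) (r : nat) : bool :=
  match c with
  | Skip => false
  | Incr r' => r == r'
  | Seq a b => writes a r || writes b r
  | While r' a => (r == r') || writes a r
  end.

Fixpoint wf_com (c : com) : bool :=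
  match c with
  | Seq a b => wf_com a && wf_com b
  | While r a => wf_com a && ~~ writes a r
  | _ => true
  end.

Fixpoint den (c : com) (g : nat -> nat) : nat -> nat :=
  match c with
  | Skip => g
  | Incr r => upd g r (g r).+1
  | Seq a b => den b (den a g)
  | While r a => iter (g r) (fun g => den a (upd g r (g r).-1)) g
  end.

Lemma updE (A : Type) (f : nat -> A) i a j : upd f i a j = if j == i then a else f j.
Proof. by []. Qed.

Lemma den_unwritten c g r : ~~ writes c r -> den c g r = g r.
Proof.
elim: c g => [|r'|a IHa b IHb|r' a IHa] g //=.
- by rewrite updE => /negbTE ->.
- by rewrite negb_or => /andP[ha hb]; rewrite IHb // IHa.
- rewrite negb_or => /andP[/negbTE hr ha].
  by elim: (g r') => //= n IH; rewrite IHa // updE hr.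
Qed.

Lemma den_seq a b g : den (Seq a b) g = den b (den a g).
Proof. by []. Qed.

Definition exec (P : seq instr) (c c' : config) := exists k, iter k (step P) c = c'.

Lemma exec_refl P c : exec P c c. Proof. by exists 0. Qed.

Lemma exec_trans P c1 c2 c3 : exec P c1 c2 -> exec P c2 c3 -> exec P c1 c3.
Proof. by move=> [k <-] [l <-]; exists (l + k); rewrite iterD. Qed.

Lemma exec_step P c c' : exec P (step P c) c' -> exec P c c'.
Proof. by move=> [k <-]; exists k.+1; rewrite iterSr. Qed.

Definition code_at (P : seq instr) off (Q : seq instr) :=
  forall i x, onth Q i = Some x -> onth P (off + i) = Some x.

Lemma code_at_cat P off Q1 Q2 : code_at P off (Q1 ++ Q2) ->
  code_at P off Q1 /\ code_at P (off + size Q1) Q2.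
Proof.
move=> h; split=> i x e.
  apply: h; rewrite onth_cat; case: ltnP => //.
  by rewrite -onthNE e.
by rewrite -addnA; apply: h; rewrite onth_cat ltnNge leq_addr /= addKn.
Qed.

Lemma code_at_cons P off x Q : code_at P off (x :: Q) ->
  onth P off = Some x /\ code_at P off.+1 Q.
Proof.
rewrite -cat1s => /code_at_cat[h1 h2]; split; last by rewrite -addn1.
by rewrite -[off]addn0; apply: h1.
Qed.

(** The register [z] is never written and stays 0, so the closing [Dec z off] of a loop always jumps
    back to its test. *)
Lemma exec_com z P c off g : wf_com c -> ~~ writes c z -> g z = 0 ->
  code_at P off (comp z off c) ->
  exec P (off, g) (off + size (comp z off c), den c g).
Proof.
elim: c off g => [|r|a IHa b IHb|r a IHa] off g /=.
- by move=> _ _ _ _; rewrite addn0; exact: exec_refl.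
- move=> _ _ _ /code_at_cons[h _]; apply: exec_step; rewrite /= h addn1.
  exact: exec_refl.
- move=> /andP[wa wb]; rewrite negb_or => /andP[za zb] g0 /code_at_cat[ha hb].
  apply: exec_trans (IHa _ _ wa za g0 ha) _.
  rewrite size_cat addnA; apply: IHb => //.
  by rewrite den_unwritten.
- move=> /andP[wa ra]; rewrite negb_or => /andP[zr za] g0 /code_at_cons[hd].
  rewrite -cats1 => /code_at_cat[ha /code_at_cons[hj _]].
  rewrite /= size_cat addn1.
  have it n g' : iter n.+1 (fun g => den a (upd g r (g r).-1)) g' =
      iter n (fun g => den a (upd g r (g r).-1)) (den a (upd g' r (g' r).-1)).
    exact: iterSr.
  move e: (g r) => n; elim: n g g0 e => [|n IH] g g0 e.
    by apply: exec_step; rewrite /step hd e; exact: exec_refl.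
  rewrite it e; apply: exec_step; rewrite /step hd e.
  have g10 : upd g r n z = 0 by rewrite updE (negbTE zr).
  apply: exec_trans (IHa _ _ wa za g10 ha) _.
  apply: exec_step; rewrite /step hj den_unwritten // g10.
  apply: IH; first by rewrite den_unwritten.
  by rewrite den_unwritten // updE eqxx.
Qed.

Lemma den_incrs s g : den (foldr (fun r => Seq (Incr r)) Skip s) g =
  fun q => g q + count_mem q s.
Proof.
elim: s g => [|r s IH] g /=; apply/funext => q; first by rewrite addn0.
by rewrite IH updE eq_sym; case: eqP => [->|_] /=; lia.
Qed.

Definition transfer r s := While r (foldr (fun r => Seq (Incr r)) Skip s).

Lemma den_transfer r s g : r \notin s ->
  den (transfer r s) g = fun q => if q == r then 0 else g q + count_mem q s * g r.
Proof.
move=> rs /=; set F := fun g => _.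
have itF n : n <= g r ->
    iter n F g = fun q => if q == r then g r - n else g q + count_mem q s * n.
  elim: n => [|n IH] nr /=.
    by apply/funext => q; case: eqP => [->|_]; rewrite ?subn0 ?muln0 ?addn0.
  rewrite (IH (ltnW nr)) /F den_incrs; apply/funext => q; rewrite !updE eqxx.
  case: eqP => [->|_]; last by rewrite mulnS -addnA [X in _ + X]addnC.
  by rewrite (count_memPn rs); lia.
rewrite itF //; apply/funext => q; case: eqP => // _; exact: subnn.
Qed.

(* The registers 1, 2, 3 are a loop counter, an auxiliary register and a register
   that always contains 0. *)
Definition dbl (b : bool) := Seq (transfer 0 [:: 2; 2])
  (Seq (if b then Incr 2 else Skip) (transfer 2 [:: 0])).

Lemma den_dbl b g : g 2 = 0 -> den (dbl b) g = upd g 0 (b + (g 0).*2).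
Proof.
move=> g2; have e g' : den (dbl b) g' = den (transfer 2 [:: 0])
    (den (if b then Incr 2 else Skip) (den (transfer 0 [:: 2; 2]) g')) by [].
rewrite e den_transfer // (den_transfer (s := [:: 2; 2])) //.
apply/funext => q; rewrite updE; case: b {e} => /=; rewrite ?updE;
  case: q => [|[|[|q]]] //=; rewrite ?g2; lia.
Qed.

(** [CodeSeq.code (x :: s)] is [2 ^ x * (CodeSeq.code s).*2.+1]: one doubling that adds 1, then [x]
    plain doublings. *)
Definition cons_com (x : nat) := Seq (dbl true) (iter x (Seq (dbl false)) Skip).

Lemma den_cons_com x g : g 2 = 0 ->
  den (cons_com x) g = upd g 0 (2 ^ x * (g 0).*2.+1).
Proof.
move=> g2; rewrite /cons_com den_seq den_dbl //.
set m := _ + _; rewrite -[X in upd g 0 (_ * X)]/m; move: m => m.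
elim: x m => [|x IH] m; first by rewrite mul1n.
rewrite iterS den_seq den_dbl //.
set h := upd _ _ _; have -> : h = upd g 0 (m.*2).
  by apply/funext => q; rewrite /h !updE; case: eqP.
by rewrite IH expnS -muln2; congr (upd g 0 _); lia.
Qed.

Definition prepend (w : seq nat) := foldr (fun x c => Seq c (cons_com x)) Skip w.

Lemma den_prepend w s g : g 0 = CodeSeq.code s -> g 2 = 0 ->
  den (prepend w) g = upd g 0 (CodeSeq.code (w ++ s)).
Proof.
move=> g0 g2; elim: w => [|x w IH].
  by rewrite /= -g0; apply/funext => q; rewrite updE; case: eqP => [->|].
rewrite [prepend _]/= den_seq IH den_cons_com ?updE //=.
by apply/funext => q; rewrite !updE; case: eqP.
Qed.

End machines.

(** * The halting formula *)

Section run_formula.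
Local Open Scope nat_scope.
Variable (R : realType) (P : seq instr).

Definition reg_of (i : instr) := match i with Inc r | Dec r _ => r end.

Definition nregs := (\max_(l < size P) reg_of (nth (Inc 0) P l)).+1.

(* X r holds the contents of register r, W r the contents expected at the next
   time, and L l the times at which the program counter is l, where every
   position outside of the program counts as size P. *)
Definition varX r := (3 * r).+4.+4.+4.+4.+4.
Definition varW r := (3 * r).+1.+4.+4.+4.+4.+4.
Definition varL l := (3 * l).+2.+4.+4.+4.+4.+4.

Definition MIff p q := MAnd (MImp p q) (MImp q p).

Definition Column X := AllRound (AllCell 1 3 (MAnd
  (MAll true 3 10 (MNext true 10 11 (MImp (MIn 11 X) (MIn 10 X))))
  (MEx true 3 10 (MNot (MIn 10 X))))).

Definition Same X Y := MAll true 3 10 (MIff (MIn 10 X) (MIn 10 Y)).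

(** The height of [X] is the truncated predecessor of that of [Y]. [Dec] uses this directly; [Inc]
    uses it in the converse direction, with a nonempty new column. *)
Definition Pred X Y := MAll true 3 10 (MNext true 10 11 (MIff (MIn 10 X) (MIn 11 Y))).

Definition Init := AllRound (MNext false 1 3 (MAnd (MIn 3 (varL 0)) (MAnd (Same (varX 0) 0)
  (MAnds (iota 1 nregs.-1) (fun r => MNot (MIn 3 (varX r))))))).

Definition Unchanged r :=
  MAnds [seq r' <- iota 0 nregs | r' != r] (fun r' => Same (varW r') (varX r')).

Definition Execute l i := match i with
  | Inc r => MAnd (MIn 4 (varL l.+1))
               (MAnd (MAnd (MIn 3 (varW r)) (Pred (varX r) (varW r))) (Unchanged r))
  | Dec r l' => MAnd (MAnd (MImp (MIn 3 (varX r)) (MIn 4 (varL l.+1)))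
                           (MImp (MNot (MIn 3 (varX r))) (MIn 4 (varL (minn l' (size P))))))
                     (MAnd (Pred (varW r) (varX r)) (Unchanged r))
  end.

(** A time marked with a position inside the program may not also be marked with [size P], so the
    halting mark that [Run] demands in every round cannot be set too early. *)
Definition Steps := AllRound (AllCell 1 3 (MNext false 3 4 (MAnds (iota 0 (size P)) (fun l =>
  MImp (MIn 3 (varL l)) (MAnd (MNot (MIn 3 (varL (size P)))) (Execute l (nth (Inc 0) P l))))))).

Definition Run := MAnd (MAnd Init Steps) (MAnd (AllRound (ExCell 1 3 (MIn 3 (varL (size P)))))
  (MAnds (iota 0 nregs) (fun r => MAnd (MAnd (Column (varX r)) (Column (varW r)))
                                       (Theta (3 * r).+1 (3 * r))))).

Definition run_vars := iota 20 (3 * maxn nregs (size P).+1).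

Definition run_formula := compile (foldr MEx2 Run run_vars).

Definition halts n := exists k, size P <= (iter k (step P) (start n)).1.

Lemma reg_lt l : l < size P -> reg_of (nth (Inc 0) P l) < nregs.
Proof.
move=> lP; rewrite ltnS.
exact: (leq_bigmax (F := fun l : 'I_(size P) => reg_of (nth (Inc 0) P l)) (Ordinal lP)).
Qed.

Lemma mwf_run : mwf (foldr MEx2 Run run_vars).
Proof.
have -> : mwf (foldr MEx2 Run run_vars) = mwf Run by elim: run_vars.
have un r : mwf (Unchanged r) by apply: mwf_MAnds.
have ex l i : mwf (Execute l i) by case: i => [r|r l'] /=; rewrite un.
rewrite /Run; do !(apply/andP; split=> //).
- by apply: mwf_MAnds.
- by apply: mwf_MAnds => l _ /=; exact: ex.
- by apply: mwf_MAnds.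
Qed.

Lemma all_cellsP e E p (Q : nat -> nat -> Prop) :
  (forall i j e', e' 3 = cellv (nseq i true) j -> (msat R e' E p <-> Q i j)) ->
  msat R e E (AllRound (AllCell 1 3 p)) <-> forall i j, Q i j.
Proof.
by move=> h; split=> h' i j;
  [apply: iffLR (h _ _ _ _) (h' i j)|apply: iffRL (h _ _ _ _) (h' i j)].
Qed.

Lemma msat_and e E p q : msat R e E (MAnd p q) = (msat R e E p /\ msat R e E q).
Proof. by []. Qed.

Lemma msat_imp e E p q : msat R e E (MImp p q) = (msat R e E p -> msat R e E q).
Proof. by []. Qed.

Lemma msat_in e E x X : msat R e E (MIn x X) = (E X (e x) = true).
Proof. by []. Qed.

Lemma msat_not e E p : msat R e E (MNot p) = ~ msat R e E p.
Proof. by []. Qed.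

Definition msatE := (msat_and, msat_imp, msat_in, msat_not).

Lemma columnP e E X : msat R e E (Column X) <->
  exists g : nat -> nat -> nat, forall i j k, E X (node i j k) = (k < g i j).
Proof.
have -> : msat R e E (Column X) = forall i j,
    (forall k, E X (rcons (node i j k) true) = true -> E X (node i j k) = true) /\
    exists k, E X (node i j k) <> true by [].
have nodeS i j k : rcons (node i j k) true = node i j k.+1 by exact: rcons_cat_nseq.
split=> [h|[g hg] i j].
  have ex i j : exists k, ~~ E X (node i j k).
    by have [_ [k hk]] := h i j; exists k; apply/negP.
  (* The height is the first missing level; downward closure excludes all higher ones. *)
  exists (fun i j => ex_minn (ex i j)) => i j k; case: ex_minnP => m nm hm.
  apply/idP/idP => [hk|km]; last by apply/negPn/negP => /hm; rewrite leqNgt km.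
  rewrite ltnNge; apply/negP => mk; move/negP: nm; apply.
  rewrite -(subKn mk); elim: (k - m) => [|d IH]; first by rewrite subn0.
  have [dk|dk] := ltnP d k; last by move: IH; have -> : k - d.+1 = k - d by lia.
  by apply: (proj1 (h i j)); rewrite nodeS -subSn // subSS.
split; last by exists (g i j); rewrite hg ltnn.
by move=> k; rewrite nodeS !hg; exact: ltnW.
Qed.

Lemma ltn_eq (a b : nat) : (forall k, (k < a) = (k < b)) -> a = b.
Proof.
by move=> h; case: (ltngtP a b) => // ab; [have := h a|have := h b]; rewrite ltnn ab.
Qed.

Lemma sameP e E X Y i j a b : e 3 = cellv (nseq i true) j ->
  (forall k, E X (node i j k) = (k < a)) -> (forall k, E Y (node i j k) = (k < b)) ->
  msat R e E (Same X Y) <-> a = b.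
Proof.
move=> e3 hX hY.
have -> : msat R e E (Same X Y) = forall k,
  (E X (e 3 ++ nseq k true) = true -> E Y (e 3 ++ nseq k true) = true) /\
  (E Y (e 3 ++ nseq k true) = true -> E X (e 3 ++ nseq k true) = true) by [].
rewrite e3; split=> [h|ab k]; last by rewrite -/(node i j k) hX hY ab.
by apply: ltn_eq => k; have := h k; rewrite -/(node i j k) hX hY => -[h1 h2]; apply/idP/idP.
Qed.

Lemma predP e E X Y i j a b : e 3 = cellv (nseq i true) j ->
  (forall k, E X (node i j k) = (k < a)) -> (forall k, E Y (node i j k) = (k < b)) ->
  msat R e E (Pred X Y) <-> a = b.-1.
Proof.
move=> e3 hX hY.
have -> : msat R e E (Pred X Y) = forall k,
  (E X (e 3 ++ nseq k true) = true -> E Y (rcons (e 3 ++ nseq k true) true) = true) /\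
  (E Y (rcons (e 3 ++ nseq k true) true) = true -> E X (e 3 ++ nseq k true) = true) by [].
have lt k : (k < b.-1) = (k.+1 < b) by case: b {hY}.
rewrite e3; split=> [h|ab k].
  apply: ltn_eq => k; rewrite lt; have := h k.
  by rewrite rcons_cat_nseq -/(node i j k) -/(node i j k.+1) hX hY => -[h1 h2]; apply/idP/idP.
by rewrite rcons_cat_nseq -/(node i j k) -/(node i j k.+1) hX hY -lt ab.
Qed.

Section registers.
Variables (E : nat -> tree) (g w : nat -> nat -> nat -> nat).
Hypothesis hX : forall r i j k, r < nregs -> E (varX r) (node i j k) = (k < g r i j).
Hypothesis hW : forall r i j k, r < nregs -> E (varW r) (node i j k) = (k < w r i j).

Lemma unchangedP e r i j : e 3 = cellv (nseq i true) j ->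
  msat R e E (Unchanged r) <-> forall r', r' < nregs -> r' != r -> w r' i j = g r' i j.
Proof.
move=> e3; apply: iff_trans (msat_MAnds _ _ _ _ _) _.
split=> h r' => [lt ne|].
  apply/(sameP e3 (fun k => hW i j k lt) (fun k => hX i j k lt)); apply: h.
  by rewrite mem_filter ne mem_iota.
rewrite mem_filter mem_iota add0n => /andP[ne /= lt].
by apply/(sameP e3 (fun k => hW i j k lt) (fun k => hX i j k lt)); exact: h.
Qed.

Definition executed l ins i j : Prop :=
  match ins with
  | Inc r => E (varL l.+1) (node i j.+1 0) = true /\ w r i j = (g r i j).+1
  | Dec r l' =>
    E (varL (if g r i j is 0 then minn l' (size P) else l.+1)) (node i j.+1 0) = true /\
                w r i j = (g r i j).-1
  end /\ forall r, r < nregs -> r != reg_of ins -> w r i j = g r i j.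

Lemma executeP e l ins i j : reg_of ins < nregs -> e 3 = cellv (nseq i true) j ->
  e 4 = cellv (nseq i true) j.+1 -> msat R e E (Execute l ins) <-> executed l ins i j.
Proof.
move=> + e3 e4; case: ins => [r|r l'] lt; rewrite /Execute !msatE.
  rewrite (unchangedP r e3) (predP e3 (fun k => hX i j k lt) (fun k => hW i j k lt)).
  rewrite /= in lt; rewrite e3 e4 !cellE hW // /executed /=.
  by split=> [[-> [[h1 h2] h3]]|[[-> h] h3]]; split=> //; split=> //; lia.
rewrite (unchangedP r e3) (predP e3 (fun k => hW i j k lt) (fun k => hX i j k lt)).
rewrite /= in lt; rewrite e3 e4 !cellE hX // /executed /=; case: (g r i j) => [|n] /=.
  by split=> [[[_ /(_ notF) ->] []]|[[-> ->] h']].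
by split=> [[[/(_ isT) -> _] []]|[[-> ->] h']].
Qed.

Lemma stepsP e : msat R e E Steps <-> forall i j l, l < size P ->
  E (varL l) (node i j 0) = true -> E (varL (size P)) (node i j 0) <> true /\
    executed l (nth (Inc 0) P l) i j.
Proof.
apply: all_cellsP => i j e' e3; set p := MAnds _ _.
have -> : msat R e' E (MNext false 3 4 p) =
  msat R (upd e' 4 (cellv (nseq i true) j.+1)) E p by rewrite -cellS -e3.
rewrite msat_MAnds; set e4 := upd _ _ _.
have e43 : e4 3 = cellv (nseq i true) j by rewrite -e3.
split=> h l; have := h l; rewrite mem_iota leq0n add0n andTb !msatE e43 cellE.
  move=> {}h lP Ll; have [h1 h2] := h lP Ll; split=> //.
  by apply/(executeP (e := e4)) => //; exact: reg_lt.
move=> {}h lP Ll; have [h1 h2] := h lP Ll; split=> //.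
by apply/(@executeP e4 _ _ i j) => //; exact: reg_lt.
Qed.

Lemma initP e n : (forall i k, E 0 (node i 0 k) = (k < n)) ->
  msat R e E Init <-> forall i, E (varL 0) (node i 0 0) = true /\
    forall r, r < nregs -> g r i 0 = upd (fun=> 0) 0 n r.
Proof.
move=> hZ.
have P0 i : msat R (upd (upd (upd e 0 [::]) 1 (nseq i true)) 3 (rcons (nseq i true) false)) E
     (MAnd (MIn 3 (varL 0)) (MAnd (Same (varX 0) 0)
  (MAnds (iota 1 nregs.-1) (fun r => MNot (MIn 3 (varX r)))))) <-> 
   E (varL 0) (node i 0 0) = true /\ forall r, r < nregs -> g r i 0 = upd (fun=> 0) 0 n r.
  set e3 := upd _ _ _.
  have e33 : e3 3 = cellv (nseq i true) 0 by rewrite /cellv cats0.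
  rewrite !msatE (sameP e33 (fun k => hX i 0 k (ltn0Sn _)) (hZ i)) msat_MAnds e33 cellE.
  split=> -[h1]; last first.
    move=> h; split=> //; split; first by rewrite h.
    move=> r; rewrite mem_iota => /andP[r0 rN]; rewrite !msatE e33 cellE hX //.
    by rewrite h // updE; case: r r0 {rN}.
  move=> [h2 h3]; split=> // -[|r] rN //.
  have := h3 r.+1; rewrite mem_iota !msatE e33 cellE hX // => h4.
  by apply/eqP; rewrite -leqn0 leqNgt; apply/negP/h4.
by split=> h i; apply/P0; exact: h.
Qed.

End registers.

Lemma msat_run e E : msat R e E Run <->
  [/\ msat R e E Init, msat R e E Steps,
      forall i, exists j, E (varL (size P)) (node i j 0) = true &
      forall r, r < nregs -> [/\ msat R e E (Column (varX r)), msat R e E (Column (varW r)) &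
        theta R (E (varW r)) (E (varX r))]].
Proof.
rewrite /Run; set fin := AllRound _; set regs := MAnds _ _.
rewrite msat_and (msat_and _ _ Init) (msat_and _ _ fin).
have -> : msat R e E fin <-> forall i, exists j, E (varL (size P)) (node i j 0) = true.
  by split=> h i; have [j hj] := h i; exists j; move: hj; rewrite -cellE.
rewrite msat_MAnds; split=> [[[h1 h2] [h3 h4]]|[h1 h2 h3 h4]]; split=> //; last split=> //.
  by move=> r rN; have := h4 r; rewrite mem_iota leq0n => /(_ rN)[[? ?] ?].
by move=> r; rewrite mem_iota => /andP[_ /h4[]].
Qed.

End run_formula.

(** * Correctness of the halting formula *)

Section run_correct.
Local Open Scope nat_scope.
Variable (R : realType) (P : seq instr).

Lemma iter_step_halted c k : size P <= c.1 -> iter k (step P) c = c.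
Proof.
case: c => pc g /= h; elim: k => //= k ->.
by rewrite /= onth_default.
Qed.

Lemma step_executed pc (g : nat -> nat) : pc < size P ->
  step P (pc, g) = match nth (Inc 0) P pc with
    | Inc r => (pc.+1, upd g r (g r).+1)
    | Dec r l => if g r is n.+1 then (pc.+1, upd g r n) else (l, g) end.
Proof.
move=> h /=; case E : (onth P pc) => [i|]; first by rewrite (onth_nth _ _ _ _ E).
by move: (onthTE P pc); rewrite E h.
Qed.

(** If the machine does not halt, every round has an error, and [theta_error] for a suitable
    register refutes [theta]. *)
Lemma run_sound e E n : (forall i k, E 0 (node i 0 k) = (k < n)) ->
  msat R e E (Run P) -> halts P n.
Proof.
move=> hZ /msat_run[init steps fin cols].
have {cols} cols r : r < nregs P -> exists g w : nat -> nat -> nat,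
    [/\ forall i j k, E (varX r) (node i j k) = (k < g i j),
        forall i j k, E (varW r) (node i j k) = (k < w i j) &
        theta R (E (varW r)) (E (varX r))].
  by move=> /cols[/columnP[g hg] /columnP[w hw] th]; exists g, w.
have /choice[g /choice[w hgw]] r : exists g w : nat -> nat -> nat, r < nregs P ->
    [/\ forall i j k, E (varX r) (node i j k) = (k < g i j),
        forall i j k, E (varW r) (node i j k) = (k < w i j) &
        theta R (E (varW r)) (E (varX r))].
  case: (ltnP r (nregs P)) => [/cols[g [w h]]|_]; first by exists g, w.
  by exists (fun _ => id), (fun _ => id).
have hX r i j k : r < nregs P -> E (varX r) (node i j k) = (k < g r i j).
  by move=> /hgw[].
have hW r i j k : r < nregs P -> E (varW r) (node i j k) = (k < w r i j).
  by move=> /hgw[].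
move/(initP R hX _ hZ): init => init; move/(stepsP R hX hW): steps => steps.
apply: contrapT => nohalt.
(* A round without error would follow the infinite run and never carry the halting mark, against
   [fin]. *)
have /choice[f /choice[rr err]] i : exists j r, r < nregs P /\ w r i j <> g r i j.+1.
  apply: contrapT => no.
  have wg r j : r < nregs P -> w r i j = g r i j.+1.
    by move=> rN; apply: contrapT => ne; apply: no; exists j, r.
  pose cfg j := iter j (step P) (start n).
  have pcP j : (cfg j).1 < size P.
    by rewrite ltnNge; apply/negP => h; apply: nohalt; exists j.
  have inv j : E (varL (cfg j).1) (node i j 0) = true /\
      forall r, r < nregs P -> g r i j = (cfg j).2 r.
    elim: j => [|j [Lj gj]]; first exact: init.
    have [_ ex] := steps i j _ (pcP j) Lj; have := pcP j.+1.
    have rN := reg_lt (pcP j).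
    rewrite /cfg iterS -/(cfg j); move: (pcP j) gj ex rN {Lj}.
    case: (cfg j) => pc h pcP' gj; rewrite step_executed // /executed.
    case: (nth _ _ _) => [r|r l] [[L wr] un] /= rN pcN.
      split=> // r' rN'; rewrite -wg // updE; case: eqP => [->|/eqP ne].
        by rewrite wr gj.
      by rewrite un // gj.
    move: L wr; rewrite gj //=; move: pcN; case hr : (h r) => [|m] /= pcN L wr.
      split; first by move: L; rewrite (minn_idPl (ltnW pcN)).
      move=> r' rN'; rewrite -wg //; case: (eqVneq r' r) => [->|ne]; first by rewrite wr hr.
      by rewrite un // gj.
    split=> // r' rN'; rewrite -wg // updE; case: eqP => [->//|/eqP ne].
    by rewrite un // gj.
  have [j] : exists j, E (varL (size P)) (node i j 0) = true.
    exact: fin.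
  by have [Lj _] := inv j; have [] := steps i j _ (pcP j) Lj.
(* There are finitely many registers, so one of them has errors in infinitely many rounds. *)
have [||r infr] := @infinite_pigeonhole xpredT rr (nregs P).
- by move=> m; exists m.
- by move=> i _; have [] := err i.
have rN : r < nregs P by have [i _ [_ <-]] := infr 0; have [] := err i.
have [hXr hWr th] := hgw r rN.
apply: (theta_error (R := R) hWr hXr (f := f) (I := fun i => rr i == r) _ _ th).
  by move=> m; have [i mi [_ /eqP ri]] := infr m; exists i.
by move=> i /eqP ri; have [_] := err i; rewrite ri.
Qed.

(** The same halting run is written in every round; its register contents are bounded, as
    [theta_correct] requires. *)
Lemma run_complete e E n : (forall i k, E 0 (node i 0 k) = (k < n)) -> halts P n ->
  exists E', (forall X, X \notin run_vars P -> E' X = E X) /\ msat R e E' (Run P).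
Proof.
move=> hZ [T hT]; pose cfg j := iter j (step P) (start n).
pose pc j := minn (cfg j).1 (size P).
pose tX r := tree_of (fun i j k => k < (cfg j).2 r).
pose tW r := tree_of (fun i j k => k < (cfg j.+1).2 r).
pose tL l := tree_of (fun i j k => (k == 0) && (pc j == l)).
(* After subtraction of 20, the remainder modulo 3 tells [varX], [varW] and [varL] apart. *)
pose E' X := if X \in run_vars P then
    match (X - 20) %% 3 with
    | 0 => tX ((X - 20) %/ 3) | 1 => tW ((X - 20) %/ 3) | _ => tL ((X - 20) %/ 3) end
  else E X.
have in_vars m : m < 3 * maxn (nregs P) (size P).+1 -> (m.+4.+4.+4.+4.+4 \in run_vars P).
  by rewrite mem_iota => h; lia.
have EX r : r < nregs P -> E' (varX r) = tX r.
  move=> rN; rewrite /E' in_vars; last by lia.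
  rewrite !subSS subn0 mulnC modnMl mulnK //.
have EW r : r < nregs P -> E' (varW r) = tW r.
  move=> rN; rewrite /E' in_vars; last by lia.
  by rewrite !subSS subn0 (_ : _ %% 3 = 1) 1?(_ : _ %/ 3 = r) //; lia.
have EL l : l <= size P -> E' (varL l) = tL l.
  move=> lN; rewrite /E' in_vars; last by lia.
  by rewrite !subSS subn0 (_ : _ %% 3 = 2) 1?(_ : _ %/ 3 = l) //; lia.
exists E'; split; first by move=> X /negbTE h; rewrite /E' h.
have hX r i j k : r < nregs P -> E' (varX r) (node i j k) = (k < (cfg j).2 r).
  by move=> rN; rewrite EX // /tX tree_ofE.
have hW r i j k : r < nregs P -> E' (varW r) (node i j k) = (k < (cfg j.+1).2 r).
  by move=> rN; rewrite EW // /tW tree_ofE.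
have hL l i j : l <= size P -> E' (varL l) (node i j 0) = (pc j == l).
  by move=> lN; rewrite EL // /tL tree_ofE.
have hZ' i k : E' 0 (node i 0 k) = (k < n).
  by rewrite /E' mem_iota /= hZ.
apply/msat_run; split.
- apply/(initP (g := fun r _ j => (cfg j).2 r) R hX _ hZ') => i.
  by rewrite hL // /pc min0n.
- apply/(stepsP (g := fun r _ j => (cfg j).2 r) (w := fun r _ j => (cfg j.+1).2 r) R hX hW).
  move=> i j l lP; rewrite !hL // ?(ltnW lP) // => /eqP pcl.
  have cl : (cfg j).1 = l by move: pcl; rewrite /pc; lia.
  split; first by rewrite pcl; apply/negP; rewrite neq_ltn lP.
  case c : (cfg j) cl => [q h] /= ql; rewrite {q}ql in c.
  have cfgS : cfg j.+1 = step P (cfg j) by [].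
  have : step P (cfg j) = step P (cfg j) by [].
  rewrite [in RHS]c step_executed // /executed; case: (nth _ _ _) => [r|r l'].
    move=> cS; split; first split.
    - by rewrite hL // /pc ?cfgS cS /= (minn_idPl lP) eqxx.
    - by rewrite ?cfgS cS /= updE eqxx c.
    - by move=> r' _ /negbTE ne; rewrite ?cfgS cS /= updE ne c.
  have -> : (cfg j).2 r = h r by rewrite c.
  case hr : (h r) => [|m] cS; split; try split.
  - by rewrite hL ?geq_minr // /pc ?cfgS cS eqxx.
  - by rewrite ?cfgS cS.
  - by move=> r' _ _; rewrite ?cfgS cS c.
  - by rewrite hL // /pc ?cfgS cS /= (minn_idPl lP) eqxx.
  - by rewrite ?cfgS cS /= updE eqxx.
  - by move=> r' _ /negbTE ne; rewrite ?cfgS cS /= updE ne c.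
- by move=> i; exists T; rewrite hL // /pc (minn_idPr hT) eqxx.
move=> r rN; split.
- by apply/columnP; exists (fun _ j => (cfg j).2 r) => i j k; exact: hX.
- by apply/columnP; exists (fun _ j => (cfg j.+1).2 r) => i j k; exact: hW.
apply: (@theta_correct R _ _ (fun _ j => (cfg j.+1).2 r) (fun _ j => (cfg j).2 r)) => //.
- by move=> i j k; exact: hW.
- by move=> i j k; exact: hX.
(* From time [T] on the configuration is constant, so the maximum up to [T] bounds all contents. *)
exists (\max_(j < T.+1) (cfg j).2 r) => _ j.
have [jT|Tj] := ltnP j.+1 T.+1.
  exact: (leq_bigmax (F := fun j : 'I_T.+1 => (cfg j).2 r) (Ordinal jT)).
rewrite -(subnK (ltnW Tj)) /cfg iterD iter_step_halted; last exact: hT.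
exact: (leq_bigmax (F := fun j : 'I_T.+1 => (cfg j).2 r) ord_max).
Qed.

Lemma msat_Ex2s s e E p :
  msat R e E (foldr MEx2 p s) <->
  exists E', (forall X, X \notin s -> E' X = E X) /\ msat R e E' p.
Proof.
elim: s E => [|X s IH] E /=.
  split=> [h|[E' [h]]]; first by exists E.
  by rewrite (_ : E' = E) //; apply/funext => X; exact: h.
split=> [[t /IH[E' [h hp]]]|[E' [h hp]]].
  exists E'; split=> // Y; rewrite inE negb_or => /andP[/negbTE YX /h ->].
  by rewrite updE YX.
exists (E' X); apply/IH; exists E'; split=> // Y Ys; rewrite updE.
by case: eqP => [->//|/eqP YX]; apply: h; rewrite inE negb_or YX.
Qed.

Lemma run_formulaP e E n : (forall i k, E 0 (node i 0 k) = (k < n)) ->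
  sat R e E (run_formula P) <-> halts P n.
Proof.
move=> hZ; rewrite /run_formula compileP ?mwf_run // msat_Ex2s.
split=> [[E' [h]]|/(run_complete e hZ)//].
by apply: run_sound => i k; rewrite h ?hZ // mem_iota.
Qed.

End run_correct.

(** * The diagonal machine *)

Section diagonal.
Local Open Scope nat_scope.

(** All exits from [P] are redirected to the first position after the copy. *)
Definition embed off (P : seq instr) := [seq match i with
  | Inc r => Inc r | Dec r l => Dec r (off + minn l (size P)) end | i <- P].

Lemma exec_embed Q off P k pc g : code_at Q off (embed off P) ->
  let c := iter k (step P) (pc, g) in
  exec Q (off + minn pc (size P), g) (off + minn c.1 (size P), c.2).
Proof.
move=> hQ; elim: k => [|k IH] /=; first exact: exec_refl.
apply: exec_trans IH _; case: (iter _ _ _) => {}pc {}g /=.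
case hP : (onth P pc) => [i|] /=; last exact: exec_refl.
have lt : pc < size P by rewrite -onthTE hP.
have := hQ pc; rewrite onth_map hP => /(_ _ erefl) hi.
apply: exec_step; rewrite /= (minn_idPl (ltnW lt)) hi.
case: i {hP hi} => [r|r l] /=; first by rewrite -addnS (minn_idPl lt); exact: exec_refl.
by case: (g r) => [|m]; rewrite /= -?addnS ?(minn_idPl lt); exact: exec_refl.
Qed.

Variables (P : seq instr) (wQ wB : seq nat).

(** The input is copied to register 1 by way of register 2; then [wQ] is prepended as many times as
    register 1 says, and finally [wB]. *)
Definition prelude := Seq (transfer 0 [:: 1; 2]) (Seq (transfer 2 [:: 0])
  (Seq (While 1 (prepend wQ)) (prepend wB))).

Lemma writes_prepend w r : r \notin [:: 0; 2] -> ~~ writes (prepend w) r.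
Proof.
rewrite !inE negb_or => /andP[/negbTE r0 /negbTE r2].
have d b : ~~ writes (dbl b) r by case: b; rewrite /= r0 r2.
elim: w => //= x w IH; rewrite negb_or IH /= -/(dbl true) -/(dbl false).
rewrite !r0 !r2 /=; elim: x => //= x IHx.
by rewrite !r0 !r2 /=.
Qed.

Lemma wf_prepend w : wf_com (prepend w).
Proof. by elim: w => //= x w ->; elim: x. Qed.

(** The auxiliary registers end at 0, so that [P] finds exactly the registers of a start
    configuration. *)
Lemma den_prelude s : let n := CodeSeq.code s in
  den prelude (start n).2 = (start (CodeSeq.code (wB ++ flatten (nseq n wQ) ++ s))).2.
Proof.
move=> n; rewrite /prelude 3!den_seq den_transfer // den_transfer //.
set g := fun q => _.
have gE : g = upd (upd (fun=> 0) 0 n) 1 n.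
  by apply/funext => -[|[|[|q]]]; rewrite /g !updE /= ?mul1n ?addn0.
have it k : k <= n -> iter k (fun g => den (prepend wQ) (upd g 1 (g 1).-1)) g =
    upd (upd (fun=> 0) 0 (CodeSeq.code (flatten (nseq k wQ) ++ s))) 1 (n - k).
  elim: k => [|k IH] kn; first by rewrite gE subn0.
  rewrite iterS (IH (ltnW kn)) (@den_prepend wQ (flatten (nseq k wQ) ++ s)) //.
  by apply/funext => -[|[|q]]; rewrite !updE //= ?catA // subnS.
have -> : den (While 1 (prepend wQ)) g =
    iter n (fun g => den (prepend wQ) (upd g 1 (g 1).-1)) g.
  by rewrite gE.
rewrite it // subnn (@den_prepend wB (flatten (nseq n wQ) ++ s)) //.
by apply/funext => -[|[|q]]; rewrite !updE.
Qed.

(* The machine halts if the result of P is 0, and loops on its last instruction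
   if the result is 1. *)
Definition diag := let c := comp 3 0 prelude in let m := size c + size P in
  c ++ embed (size c) P ++ [:: Dec 0 m.+2; Dec 0 m.+1].

Lemma diag_exec s v : let n := CodeSeq.code s in
  computes P (CodeSeq.code (wB ++ flatten (nseq n wQ) ++ s)) v ->
  exists g, g 0 = v /\ exec diag (start n) ((size diag).-2, g).
Proof.
move=> n [k]; set c := iter _ _ _; move=> [hc cv]; exists c.2; split=> //.
have sz : (size diag).-2 = size (comp 3 0 prelude) + size P.
  by rewrite /diag !size_cat size_map addnA addn2.
have cat_at : code_at diag 0 diag by [].
move: (cat_at); rewrite [X in code_at _ _ X]/diag => /code_at_cat[h1 /code_at_cat[h2 _]].
have wfp : wf_com prelude by rewrite /= !wf_prepend writes_prepend.
have w3 : ~~ writes prelude 3.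
  by rewrite /= !negb_or !writes_prepend.
have := exec_com (z := 3) (g := (start n).2) wfp w3 (erefl _) h1.
rewrite den_prelude -/n => e1; apply: exec_trans e1 _.
pose off := size (comp 3 0 prelude).
have e2 : exec diag
    (off + minn 0 (size P), (start (CodeSeq.code (wB ++ flatten (nseq n wQ) ++ s))).2)
    (off + minn c.1 (size P), c.2) := exec_embed k 0 _ h2.
by move: e2; rewrite min0n addn0 (minn_idPr hc) /off -sz add0n.
Qed.

Lemma diag_onth : onth diag (size diag).-2 = Some (Dec 0 (size diag)) /\
  onth diag (size diag).-1 = Some (Dec 0 (size diag).-1) /\ 1 < size diag.
Proof.
have sz : size diag = (size (comp 3 0 prelude) + size P).+2.
  by rewrite /diag !size_cat size_map addnA addn2.
have : code_at diag 0 diag by [].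
rewrite [X in code_at _ _ X]/diag => /code_at_cat[_ /code_at_cat[_]].
rewrite size_map add0n => /code_at_cons[h1 /code_at_cons[h2 _]].
by rewrite sz; split.
Qed.

Lemma diag_halts s : let n := CodeSeq.code s in
  computes P (CodeSeq.code (wB ++ flatten (nseq n wQ) ++ s)) 0 -> halts diag n.
Proof.
move=> n /diag_exec[g [g0 [k hk]]]; have [h _] := diag_onth.
by exists k.+1; rewrite iterS hk /step h g0.
Qed.

Lemma diag_loops s : let n := CodeSeq.code s in
  computes P (CodeSeq.code (wB ++ flatten (nseq n wQ) ++ s)) 1 -> ~ halts diag n.
Proof.
(* The answer 1 is decremented to 0, after which the last instruction jumps to itself forever. *)
move=> n /diag_exec[g [g0 [k hk]]] [l hl]; have [h1 [h2 sz]] := diag_onth.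
pose c : config := ((size diag).-1, upd g 0 0).
have hk' : iter k.+1 (step diag) (start n) = c.
  by rewrite iterS hk /step h1 g0 /c -[in RHS]subn1 -subn2; congr (_, _); lia.
have loop i : iter i (step diag) c = c by elim: i => // i IH; rewrite iterS IH /c /step h2.
have := iter_step_halted k.+1 hl; rewrite -iterD addnC iterD hk' loop => e.
suff : ~~ (size diag <= (size diag).-1) by move: hl; rewrite -e => /= ->.
by rewrite -ltnNge ltn_predL ltnW.
Qed.

End diagonal.

(** * Numerals and closed formulas *)

Section sentences.
Local Open Scope nat_scope.
Variable R : realType.

(* Set variable 0 represents the number n by the vertices u L R^k with k < n. *)
Definition represents n (Z : tree) := forall u k, Z (rcons u false ++ nseq k true) = (k < n).

(** Set 1 contains every vertex u L, and contains u R exactly when set 0 contains u; every column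
    thus grows by one. *)
Definition Extends := All1 0 (All1 1 (FAnd (FImp (SuccL 0 1) (In 1 1))
  (FImp (SuccR 0 1) (FAnd (FImp (In 1 1) (In 0 0)) (FImp (In 0 0) (In 1 1)))))).

Definition Equal := All1 0 (FAnd (FImp (In 0 0) (In 0 1)) (FImp (In 0 1) (In 0 0))).

(** Copying set 1 back to set 0 allows iteration. As [p] comes last, the Polish notation is a fixed
    word followed by that of [p], which a machine can prepend. *)
Definition Successor p := All2 1 (FImp Extends (All2 0 (FImp Equal p))).

Definition Zero p := All2 0 (FImp (All1 0 (Not (In 0 0))) p).

Lemma sat_extends e E : sat R e E Extends <->
  (forall u, E 1 (rcons u false) = true) /\ forall u, E 1 (rcons u true) = E 0 u.
Proof.
have h u v : sat R (upd (upd e 0 u) 1 v) E (FAnd (FImp (SuccL 0 1) (In 1 1))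
  (FImp (SuccR 0 1) (FAnd (FImp (In 1 1) (In 0 0)) (FImp (In 0 0) (In 1 1))))) <->
  (v = rcons u false -> E 1 v = true) /\ (v = rcons u true -> E 1 v = E 0 u).
  rewrite sat_and !sat_imp sat_and !sat_imp /=; split=> -[h1 h2]; split=> // uv.
    by have [h3 h4] := h2 uv; apply/idP/idP.
  by rewrite h2.
split=> [hE|[h1 h2] u v]; last by apply/h; split=> ->.
by split=> u; [exact: (proj1 (iffLR (h u _) (hE u _)) erefl)|
  exact: (proj2 (iffLR (h u _) (hE u _)) erefl)].
Qed.

Lemma sat_equal e E : sat R e E Equal <-> E 0 = E 1.
Proof.
split=> [h|e01]; last by apply/sat_all1 => v; apply/sat_and; rewrite !sat_imp /= e01.
apply/funext => v; have /sat_and[/sat_imp h1 /sat_imp h2] : sat R (upd e 0 v) E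
  (FAnd (FImp (In 0 0) (In 0 1)) (FImp (In 0 1) (In 0 0))) := h v.
by apply/idP/idP.
Qed.

Lemma sat_successor p n H :
  (forall e E, represents n.+1 (E 0) -> (sat R e E p <-> H)) ->
  forall e E, represents n (E 0) -> (sat R e E (Successor p) <-> H).
Proof.
move=> hp e E hZ; split=> [h|hH].
  (* The set described by [Extends], with the root put into it. *)
  pose T : tree := fun v => if last false v then E 0 (take (size v).-1 v) else true.
  have /sat_imp h1 : sat R e (upd E 1 T) (FImp Extends (All2 0 (FImp Equal p))) := h T.
  have Tl u : T (rcons u false) = true by rewrite /T last_rcons.
  have Tr u : T (rcons u true) = E 0 u by rewrite /T last_rcons size_rcons -cats1 take_size_cat.
  have /h1 h2 : sat R e (upd E 1 T) Extends by apply/sat_extends.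
  have /sat_imp h3 : sat R e (upd (upd E 1 T) 0 T) (FImp Equal p) := h2 T.
  apply/(hp e (upd (upd E 1 T) 0 T)); last by apply/h3/sat_equal.
  move=> u [|k] /=; first by rewrite cats0; exact: Tl.
  by rewrite -rcons_cat_nseq [LHS]Tr hZ.
apply/sat_all2 => T; apply/sat_imp => /sat_extends[Tl Tr].
apply/sat_all2 => T'; apply/sat_imp => /sat_equal TT'.
have {TT'} -> : T' = T := TT'.
apply/hp => // u [|k]; first by rewrite cats0; exact: Tl.
by rewrite -rcons_cat_nseq; apply: etrans (Tr _) (hZ _ _).
Qed.

Lemma sat_numeral p n H :
  (forall e E, represents n (E 0) -> (sat R e E p <-> H)) ->
  forall e E, sat R e E (Zero (iter n Successor p)) <-> H.
Proof.
move=> hp.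
have {}hp m k : m + k = n ->
    forall e E, represents k (E 0) -> (sat R e E (iter m Successor p) <-> H).
  elim: m k => [|m IH] k mk; first by rewrite add0n in mk; rewrite mk.
  by apply: sat_successor; apply: IH; rewrite addnS -mk.
move=> e E; split=> [h|hH].
  have /sat_imp h1 : sat R e (upd E 0 (fun=> false)) (FImp (All1 0 (Not (In 0 0))) _) := h _.
  by apply/(hp n 0 (addn0 n)); last by apply: h1.
apply/sat_all2 => T; apply/sat_imp => T0; apply/(hp n 0 (addn0 n)) => // u k.
by apply/negbTE/negP; exact: T0.
Qed.

(** Set variable 0 stays free to receive the numeral. Closing the others makes it unnecessary to
    compute the free variables of [run_formula]. *)
Definition close p := foldr All1 (foldr All2 p [seq X <- free2 p | X != 0]) (free1 p).

Lemma free1_all2 p s : free1 (foldr All2 p s) = free1 p.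
Proof. by elim: s. Qed.

Lemma free2_all1 p s : free2 (foldr All1 p s) = free2 p.
Proof. by elim: s. Qed.

Lemma free1_all1 p s : free1 (foldr All1 p s) = [seq x <- free1 p | x \notin s].
Proof.
elim: s => [|x s /= ->]; first by rewrite filter_predT.
by rewrite -filter_predI; apply: eq_filter => y /=; rewrite inE negb_or.
Qed.

Lemma free2_all2 p s : free2 (foldr All2 p s) = [seq X <- free2 p | X \notin s].
Proof.
elim: s => [|x s /= ->]; first by rewrite filter_predT.
by rewrite -filter_predI; apply: eq_filter => y /=; rewrite inE negb_or.
Qed.

Lemma free1_close p : free1 (close p) = [::].
Proof.
rewrite free1_all1 free1_all2; apply/eqP; rewrite -[_ == _]negbK -has_filter.
by apply/hasPn => x; rewrite negbK.
Qed.

Lemma free2_close p : all (pred1 0) (free2 (close p)).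
Proof.
rewrite free2_all1 free2_all2; apply/allP => X; rewrite !mem_filter => /andP[+ Xp].
by rewrite Xp andbT negbK.
Qed.

(** The truth of [p] is fixed once set 0 is, and the quantifiers range over nonempty domains, so
    they change nothing. *)
Lemma sat_close p n H : (forall e E, represents n (E 0) -> (sat R e E p <-> H)) ->
  forall e E, represents n (E 0) -> (sat R e E (close p) <-> H).
Proof.
move=> hp.
have {}hp e E : represents n (E 0) ->
    (sat R e E (foldr All2 p [seq X <- free2 p | X != 0]) <-> H).
  have : all (fun X => X != 0) [seq X <- free2 p | X != 0] by exact: filter_all.
  elim: [seq _ <- _ | _] E => [|X s IH] E; first by move=> _; exact: hp.
  move=> /= /andP[/negbTE X0 hs] hZ.
  have hU t : represents n (upd E X t 0) by rewrite updE eq_sym X0.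
  split=> [h|hH t]; last by apply/IH.
  by apply/(IH (upd E X (E 0))) => //; exact: h.
rewrite /close; elim: (free1 p) => //= x s IH e E hZ.
by split=> [h|hH v]; [apply/(IH (upd e x [::]) E hZ); exact: h|apply/IH].
Qed.

(** What [Successor] puts before the word of its argument: 8 is [All2], and 4, 3 begin an
    implication. *)
Definition word_successor := [:: 8, 1, 4, 3 & word Extends ++ [:: 8, 0, 4, 3 & word Equal]].

Definition word_zero := [:: 8; 0; 4; 3; 6; 0; 3; 2; 0; 0].

Lemma word_numeral n p :
  word (Zero (iter n Successor p)) = word_zero ++ flatten (nseq n word_successor) ++ word p.
Proof.
rewrite /word_zero /=; do 10 congr (_ :: _).
elim: n => // n IH; rewrite iterS.
rewrite -[flatten _]/(word_successor ++ flatten (nseq n word_successor)).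
by rewrite -catA -IH.
Qed.

Lemma sentence_numeral n p : free1 p = [::] -> all (pred1 0) (free2 p) ->
  sentence (Zero (iter n Successor p)).
Proof.
move=> p1 p2.
have {p1 p2}[p1 p2] : free1 (iter n Successor p) = [::] /\
    all (pred1 0) (free2 (iter n Successor p)).
  elim: n => // n [IH1 IH2]; rewrite iterS /= IH1; split=> //.
  apply/allP => X; rewrite !(mem_filter, mem_cat) => /andP[X1 /andP[X0 hX]].
  by move: X1 X0; rewrite (eqP (allP IH2 _ hX)).
split; rewrite /= ?p1 //; apply/eqP; rewrite -[_ == _]negbK -has_filter.
by apply/hasPn => X /(allP p2) /eqP ->.
Qed.

End sentences.

(** * The diagonal argument *)

Local Open Scope classical_set_scope.

Theorem theorem7p1 (R : realType) : ~ decidable_set (godel @` theory R).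
Proof.
move=> [P dec].
pose D := diag P word_successor word_zero.
pose psi := close (run_formula D).
(* [phi] says that [D] halts on the code of [psi], from which [D] itself computes the code of
   [phi]. *)
pose phi := Zero (iter (godel psi) Successor psi).
have phi_halts e E : sat R e E phi <-> halts D (godel psi).
  apply: sat_numeral => {}e {}E; apply: sat_close => {}e {}E hZ.
  apply: run_formulaP => i k; rewrite /node /cellv cats0; exact: hZ.
have phi_sentence : sentence phi.
  by apply: sentence_numeral; [exact: free1_close|exact: free2_close].
have godel_phi : godel phi = CodeSeq.code
    (word_zero ++ flatten (nseq (godel psi) word_successor) ++ word psi).
  by rewrite /godel word_numeral.
have [dec1 dec0] := dec (godel phi); rewrite godel_phi in dec1 dec0.
(* If [D] halts, then [phi] is true, [P] answers 1 and [D] loops. *)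
have [h|h] := pselect (halts D (godel psi)).
  apply: (@diag_loops P word_successor word_zero (word psi) _ h); apply: dec1.
  exists phi; last exact: godel_phi.
  by split=> // e E; apply/phi_halts.
(* Otherwise [phi] is false, and by injectivity of [godel] its code is not that of a true sentence;
   so [P] answers 0 and [D] halts. *)
apply/h/(@diag_halts P word_successor word_zero (word psi))/dec0.
move=> [phi' [_ hphi']]; rewrite -godel_phi => /godel_inj e'.
by apply/h/(phi_halts (fun=> [::]) (fun _ _ => false)); rewrite -e'; exact: hphi'.
Qed.
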